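(* Let $\Delta$ be a finite simplicial complex with no isolated vertices. Then: (1) the Morse complex $\mathcal{M}(\Delta)$ is connected if and only if $\Delta$ is not (isomorphic to) a single edge; (2) the Morse complex $\mathcal{M}(\Delta)$ is simply connected if and only if $\Delta$ is none of the following (up to isomorphism): an edge, a disjoint union of two edges, a path with three edges, a $3$-cycle, or a $2$-simplex.
   Context: $\Delta$ is a finite abstract simplicial complex; simplices are non-empty, and $\sigma^{(p)}$ indicates $\dim\sigma=p$. An isolated vertex is a vertex contained in no edge. ''Edge'' means the full $1$-simplex (with its two vertices), ''$3$-cycle'' means the cycle graph with three vertices and three edges (no $2$-simplex), and ''$2$-simplex'' means the full $2$-simplex with all its faces. A primitive discrete vector field on $\Delta$ is a pair $(\sigma^{(p)},\tau^{(p+1)})$ of simplices with $\sigma<\tau$. A discrete vector field $V$ on $\Delta$ is a collection of primitive discrete vector fields such that each simplex of $\Delta$ occurs in at most one pair of $V$. A $V$-path is a sequence of simplices $\sigma_0^{(p)},\tau_0^{(p+1)},\sigma_1^{(p)},\dots,\tau_{m-1}^{(p+1)},\sigma_m^{(p)}$ such that for each $0\le i\le m-1$ we have $(\sigma_i,\tau_i)\in V$ and $\tau_i>\sigma_{i+1}\ne\sigma_i$. A $V$-cycle is a $V$-path with $m>0$ and $\sigma_m=\sigma_0$. $V$ is acyclic if there are no $V$-cycles. The Morse complex $\mathcal{M}(\Delta)$ is the simplicial complex whose simplices are the non-empty acyclic discrete vector fields on $\Delta$, with face relation given by inclusion. Convention for this statement: in the degenerate case where $\Delta$ is empty, $\mathcal{M}(\Delta)$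 is empty and is regarded as (vacuously) connected and simply connected; otherwise connected and simply connected have their usual meanings for the geometric realization. *)

(* Defs.v *)
From HB Require Import structures.
From mathcomp Require Import all_boot all_order all_algebra.
From mathcomp Require Import all_classical reals topology normedtype.
From mathcomp Require Import finset. (* set0 is the empty {set T} *)
Import Order.TTheory GRing.Theory Num.Theory.
Import numFieldNormedType.Exports.

Set Implicit Arguments.
Unset Strict Implicit.
Unset Printing Implicit Defensive.

(* The vertices of a complex are the points v of T such that [set v] is a     *)
(* simplex; the other points of T play no role. The complex may be empty.     *)
Record simplicial_complex (T : finType) := SimplicialComplex {
  simplices :> {set {set T}};
  simplex_neq0 : forall s : {set T}, s \in simplices -> s != set0;
  simplex_face : forall s t : {set T},
    s \in simplices -> t \subset s -> t != set0 -> t \in simplices }.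

Section Complexes.
Variable T : finType.
Implicit Types (K : simplicial_complex T) (s t : {set T}).

Definition vertices K : {set T} := [set v | [set v] \in K].

(* Only meaningful for non-empty s. *)
Definition dim s : nat := #|s|.-1.

Definition isolated_vertex K (v : T) : Prop :=
  v \in vertices K /\ ~ exists e, [/\ e \in K, dim e = 1%N & v \in e].

End Complexes.

(* Since f is total, this excludes the degenerate case of an empty K on an    *)
(* inhabited T and an empty type U, which does not occur for the models below.*)
Definition isomorphic (T U : finType)
    (K : simplicial_complex T) (L : simplicial_complex U) : Prop :=
  exists f : T -> U,
    [/\ {in vertices K &, injective f},
        f @: vertices K = vertices L &
        forall s : {set T}, s \subset vertices K -> (s \in K) = (f @: s \in L)].

Section Generated.
Variables (n : nat) (F : seq (seq nat)).

(* The complex on the vertices 0, ..., n - 1 whose simplices are the          *)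
(* non-empty subsets of the members of F.                                     *)
Definition generated_simplices : {set {set 'I_n}} :=
  [set s : {set 'I_n} |
    (s != set0) && has (fun f => [forall v in s, val v \in f]) F].

Lemma generated_neq0 s : s \in generated_simplices -> s != set0.
Proof. by rewrite inE => /andP[]. Qed.

Lemma generated_face (s t : {set 'I_n}) : s \in generated_simplices ->
  t \subset s -> t != set0 -> t \in generated_simplices.
Proof.
rewrite !inE => /andP[_ /hasP[f Ff /forall_inP sf]] /fintype.subsetP ts ->.
by apply/hasP; exists f => //; apply/forall_inP => v /ts /sf.
Qed.

Definition generated_complex : simplicial_complex 'I_n :=
  SimplicialComplex generated_neq0 generated_face.

End Generated.

Definition edge := generated_complex 2 [:: [:: 0; 1]].
Definition two_edges := generated_complex 4 [:: [:: 0; 1]; [:: 2; 3]].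
Definition path_three_edges :=
  generated_complex 4 [:: [:: 0; 1]; [:: 1; 2]; [:: 2; 3]].
Definition three_cycle :=
  generated_complex 3 [:: [:: 0; 1]; [:: 1; 2]; [:: 0; 2]].
Definition two_simplex := generated_complex 3 [:: [:: 0; 1; 2]].

Section Morse.
Variables (T : finType) (K : simplicial_complex T).
Implicit Types (V W : {set {set T} * {set T}}) (a : {set T} * {set T}).

Definition primitive_dvf a : Prop :=
  [/\ a.1 \in K, a.2 \in K, a.1 \proper a.2 & dim a.2 = (dim a.1).+1].

Definition occurs (s : {set T}) a : Prop := s = a.1 \/ s = a.2.

Definition discrete_vf V : Prop :=
  (forall a, a \in V -> primitive_dvf a) /\
  (forall s a b, s \in K -> a \in V -> b \in V ->
     occurs s a -> occurs s b -> a = b).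

(* Only sigma 0, ..., sigma m and tau 0, ..., tau (m - 1) matter. *)
Definition V_path V (m : nat) (sigma tau : nat -> {set T}) : Prop :=
  exists p,
    (forall i, (i <= m)%N -> sigma i \in K /\ dim (sigma i) = p) /\
    (forall i, (i < m)%N ->
      [/\ tau i \in K, dim (tau i) = p.+1, (sigma i, tau i) \in V,
          sigma i.+1 \proper tau i & sigma i.+1 != sigma i]).

Definition V_cycle V (m : nat) (sigma tau : nat -> {set T}) : Prop :=
  [/\ V_path V m sigma tau, (0 < m)%N & sigma m = sigma 0%N].

Definition acyclic V : Prop := ~ exists m sigma tau, V_cycle V m sigma tau.

Definition morse_simplices : {set {set {set T} * {set T}}} :=
  [set V | (V != set0) && `[< discrete_vf V /\ acyclic V >]].

Lemma morse_neq0 V : V \in morse_simplices -> V != set0.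
Proof. by rewrite inE => /andP[]. Qed.

Lemma morse_face V W :
  V \in morse_simplices -> W \subset V -> W != set0 -> W \in morse_simplices.
Proof.
rewrite !inE => /andP[_ /asboolP[[Vprim Vuniq] Vacy]] /fintype.subsetP WV ->.
apply/asboolP; split; first split.
- by move=> a /WV /Vprim.
- by move=> s a b Ks /WV Va /WV Vb; apply: Vuniq Ks Va Vb.
- move=> [m [sigma [tau [[p [Hs Ht]] m_gt0 sm]]]]; apply: Vacy.
  exists m, sigma, tau; split=> //; exists p; split=> // i /Ht[? ? st ? ?].
  by split=> //; apply: WV.
Qed.

Definition morse_complex : simplicial_complex ({set T} * {set T})%type :=
  SimplicialComplex morse_neq0 morse_face.

End Morse.

Local Open Scope classical_set_scope.
Local Open Scope ring_scope.

(* Barycentric coordinates, topologized as a subspace of R^T. *)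
Definition geometric_realization (R : realType) (T : finType)
    (K : simplicial_complex T) : set {ptws T -> R} :=
  [set x : {ptws T -> R} |
    [/\ forall v, 0 <= x v, \sum_v x v = 1 &
        [set v | x v != 0]%SET \in K]].

Arguments geometric_realization R {T} K.

Section SimplyConnected.
Variables (R : realType) (X : topologicalType) (A : set X).

Definition path_in (f : R -> X) (x y : X) : Prop :=
  [/\ {within `[0, 1], continuous f}, f @` `[0, 1] `<=` A,
      f 0 = x & f 1 = y].

(* Homotopy of paths in A relative to the end points. *)
Definition path_homotopic (f g : R -> X) : Prop :=
  exists H : R * R -> X,
    [/\ {within `[0, 1] `*` `[0, 1], continuous H},
        H @` (`[0, 1] `*` `[0, 1]) `<=` A,
        {in `[0, 1], forall s, H (s, 0) = f s /\ H (s, 1) = g s} &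
        {in `[0, 1], forall t, H (0, t) = f 0 /\ H (1, t) = f 1}].

(* This holds vacuously for the empty set. *)
Definition simply_connected : Prop :=
  (forall x y, A x -> A y -> exists f, path_in f x y) /\
  (forall x f, A x -> path_in f x x -> path_homotopic f (cst x)).

End SimplyConnected.

Arguments simply_connected R {X} A.

(* Main.v *)
(* Vectors of the Morse complex are the edges of the Hasse diagram of K, and
   simplices are acyclic matchings in it. Two disjoint vectors always form a
   simplex; three pairwise disjoint ones do unless they run around a hollow
   triangle, and then a fourth vector, avoiding all three, fills the gap, except
   when K is a 3-cycle or a 2-simplex. Thus loops may be contracted as in the
   matching complex of the Hasse diagram. If a is a vector (v, vw), with v a leaf
   when there is one, the vectors disjoint from a form a cone, and every other
   vector b is attached along the vectors disjoint from both a and b; these are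
   connected because a vertex-edge incidence can be found away from any given
   vector, except in the listed complexes. In the exceptional complexes some
   vector has a disconnected link that does not disconnect the Morse complex,
   which yields a nontrivial double cover.

   Combinatorial simple connectivity, in the form "every local system on the
   1-skeleton has a flat section", is applied to the local system of homotopy
   classes of paths; conversely a double cover is trivialized over the square by
   gluing local sections, so its monodromy is a homotopy invariant. *)
From mathcomp Require Import all_boot all_order all_algebra.
From mathcomp Require Import all_classical reals topology normedtype.
From mathcomp Require Import finset ring lra.
Require Import Defs.
Import Order.TTheory GRing.Theory Num.Theory.
Import numFieldNormedType.Exports.

Set Implicit Arguments.
Unset Strict Implicit.
Unset Printing Implicit Defensive.

(** * Simplices of the Morse complex *)

(** Simple connectivity depends only on the 2-skeleton, so no simplex with more than three vectors
    is ever examined.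

    A leaf [v] is the preferred place for the hub because only the opposite incidence of its edge
    then clashes with [(v, vw)]. Without a leaf every vertex has two neighbours and, triangles being
    excluded, there are at least four vertices, whereas a witness never has to start off more than
    three. Witnesses are sought among vertex-edge incidences because these clash in a simple
    pattern: distinct edges share at most one vertex.

    Flat sections play the role of van Kampen's theorem: a section is written down from its value at
    the hub, without presentations of groups. For the negative results a Boolean cocycle is enough,
    since in each exceptional complex other than the edge some loop crosses the cut once. On the
    analytic side one principle, that a local and additive property of intervals holds for the unit
    interval, takes the place of every Lebesgue-number argument. *)

Section MorseSimplices.
Variables (T : finType) (K : simplicial_complex T).
Local Notation vec := ({set T} * {set T})%type.
Implicit Types (p q r a b : vec) (u v w x y z : T) (s t : {set T}).

Local Notation prim := (primitive_dvf K).

Lemma prim_card p : prim p -> #|p.2| = #|p.1|.+1.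
Proof.
case=> /simplex_neq0; rewrite -card_gt0 => p1 /simplex_neq0; rewrite -card_gt0.
by move=> p2 _; rewrite /dim; case: #|p.1| p1 => // n _; case: #|p.2| p2 => //= m _ ->.
Qed.

Lemma prim_gt0 p : prim p -> (0 < #|p.1|)%N.
Proof. by case=> /simplex_neq0; rewrite -card_gt0. Qed.

Lemma prim_sub p : prim p -> p.1 \subset p.2.
Proof. by case=> _ _ /proper_sub sub _. Qed.

Definition disj p q :=
  [&& p.1 != q.1, p.1 != q.2, p.2 != q.1 & p.2 != q.2].

Lemma disjC p q : disj p q = disj q p.
Proof.
by rewrite /disj ![_ == q.1]eq_sym ![_ == q.2]eq_sym; do 4![case: (_ == _)].
Qed.

Lemma disj_irr p : disj p p = false. Proof. by rewrite /disj eqxx. Qed.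

(** Equality is allowed because [[set p; q; r]] does not force its entries to be distinct, and local
    systems are tested on such degenerate simplices too. *)
Definition compat p q := (p == q) || disj p q.

Lemma compatC p q : compat p q = compat q p.
Proof. by rewrite /compat eq_sym disjC. Qed.

Lemma compatxx p : compat p p. Proof. by rewrite /compat eqxx. Qed.

Lemma disj_compat p q : disj p q -> compat p q.
Proof. by rewrite /compat orbC => ->. Qed.

(** The inclusions force both bottoms to have the same size; both tops then coincide with the union
    of the bottoms, which disjointness forbids. *)
Lemma no_2cycle p q : prim p -> prim q -> disj p q ->
  q.1 \subset p.2 -> p.1 \subset q.2 -> False.
Proof.
move=> pp pq /and4P[n11 n12 n21 n22] qp pq'.
have cp := prim_card pp; have cq := prim_card pq.
have h1 : (#|q.1| < #|p.2|)%N.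
  by apply: proper_card; rewrite properEneq eq_sym n21.
have h2 : (#|p.1| < #|q.2|)%N by apply: proper_card; rewrite properEneq n12.
have e : #|p.1| = #|q.1| by apply/eqP; rewrite eqn_leq -ltnS -cq h2 -ltnS -cp h1.
have : (#|p.1| < #|p.1 :|: q.1|)%N.
  apply: proper_card; rewrite properE subsetUl; apply/negP => sub.
  case/negP: n11; rewrite eq_sym eqEcard e leqnn andbT.
  exact: fintype.subset_trans (subsetUr _ _) sub.
move=> lt; have : p.1 :|: q.1 == p.2.
  by rewrite eqEcard subUset (prim_sub pp) qp cp.
have : p.1 :|: q.1 == q.2.
  by rewrite eqEcard subUset (prim_sub pq) pq' cq -e.
by move=> /eqP e1 /eqP e2; rewrite -e1 -e2 eqxx in n22.
Qed.

(* [p], [q], [r] in this order form a closed V-path of length 3. *)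
Definition cyc3 p q r :=
  [&& p.1 != q.1, q.1 != r.1, r.1 != p.1,
      q.1 \subset p.2, r.1 \subset q.2 & p.1 \subset r.2].

Lemma cyc3_rot p q r : cyc3 p q r = cyc3 q r p.
Proof. by rewrite /cyc3; do 6![case: (_ \subset _) || case: (_ == _)]. Qed.

(** A closed V-path never stands still and, by [no_2cycle], never turns back after two steps; among
    three vectors it can only run around all of them, in one of the two cyclic orders. *)
Lemma acyclic3 p q r : prim p -> prim q -> prim r ->
  compat p q -> compat q r -> compat r p ->
  ~~ cyc3 p q r -> ~~ cyc3 p r q -> acyclic K [set p; q; r].
Proof.
move=> Pp Pq Pr pq qr rp c1 c2 [m [sigma [tau [[d [Hs Ht]] m0 e]]]].
set V := [set p; q; r] in Ht.
have VP a : a \in V -> prim a.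
  by rewrite !inE => /orP[/orP[]|] /eqP->.
have VC a b : a \in V -> b \in V -> a != b -> disj a b.
  move=> aV bV nab; suff: compat a b by rewrite /compat (negbTE nab).
  by move: aV bV; rewrite !inE => /orP[/orP[]|] /eqP-> /orP[/orP[]|] /eqP->;
    rewrite ?compatxx // compatC.
have st i : (i < m)%N -> (sigma i, tau i) \in V by case/Ht.
have nx i : (i < m)%N -> sigma i.+1 \subset tau i.
  by case/Ht => _ _ _ /proper_sub.
have ne i : (i < m)%N -> sigma i.+1 != sigma i by case/Ht.
have D i j : (i < m)%N -> (j < m)%N -> sigma i != sigma j ->
    disj (sigma i, tau i) (sigma j, tau j).
  move=> im jm nij; apply: VC; rewrite ?st //.
  by apply: contra nij => /eqP[->].
have ne2 i : (i.+1 < m)%N -> sigma i.+2 != sigma i.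
  move=> im; have im' := ltnW im; apply/eqP => e2.
  apply: (@no_2cycle (sigma i, tau i) (sigma i.+1, tau i.+1)).
  - exact: VP (st _ im').
  - exact: VP (st _ im).
  - by rewrite D // eq_sym ne.
  - exact: nx.
  - by rewrite /= -e2 nx.
case: m => [//|[|[|m]]] in e m0 Hs Ht st nx ne D ne2 *.
- by have := ne 0%N isT; rewrite e eqxx.
- by have := ne2 0%N isT; rewrite e eqxx.
have n01 := ne 0%N isT; have n12 := ne 1%N isT; have n02 := ne2 0%N isT.
have V0 := st 0%N isT; have V1 := st 1%N isT; have V2 := st 2%N isT.
(* A longer path already closes after three steps: its fourth vector differs from the second and the
   third, and [V] has at most three members. *)
have s30 : sigma 3%N = sigma 0%N.
  case: m => [//|m] in e m0 Hs Ht st nx ne D ne2 *.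
  have V3 := st 3%N isT; have n23 := ne 2%N isT; have n13 := ne2 1%N isT.
  have pig a0 a1 a2 a3 : a0 \in V -> a1 \in V -> a2 \in V -> a3 \in V ->
    a0 != a1 -> a1 != a2 -> a2 != a0 -> a3 != a1 -> a3 != a2 -> a3 = a0.
    rewrite !inE.
    by move=> /orP[/orP[]|] /eqP-> /orP[/orP[]|] /eqP-> /orP[/orP[]|] /eqP->
      /orP[/orP[]|] /eqP->; rewrite ?eqxx.
  have nn i j : sigma i != sigma j -> (sigma i, tau i) != (sigma j, tau j).
    by apply: contra => /eqP[->].
  have := pig _ _ _ _ V0 V1 V2 V3.
  rewrite !nn // 1?eq_sym // => /(_ isT isT isT isT isT) [] //.
have cc : cyc3 (sigma 0, tau 0)%N (sigma 1, tau 1)%N (sigma 2, tau 2)%N.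
  rewrite /cyc3 /= [sigma 0%N == _]eq_sym n01 [sigma 1%N == _]eq_sym n12 n02.
  by rewrite -s30 !nx.
have negc a b : cyc3 a a b = false by rewrite /cyc3 eqxx.
have negc' a b : cyc3 a b b = false by rewrite /cyc3 eqxx andbF.
have negc'' a b : cyc3 a b a = false by rewrite /cyc3 eqxx !andbF.
have c1' := negbTE c1; have c2' := negbTE c2.
have r1 : cyc3 q r p = false by rewrite -cyc3_rot.
have r2 : cyc3 r p q = false by rewrite cyc3_rot.
have r3 : cyc3 r q p = false by rewrite -cyc3_rot.
have r4 : cyc3 q p r = false by rewrite cyc3_rot.
move: cc; rewrite !inE in V0 V1 V2.
by case/orP: V0 => [/orP[]|] /eqP->; case/orP: V1 => [/orP[]|] /eqP->;
  case/orP: V2 => [/orP[]|] /eqP->;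
  rewrite ?negc ?negc' ?negc'' ?c1' ?c2' ?r1 ?r2 ?r3 ?r4.
Qed.

Lemma morse3 p q r : prim p -> prim q -> prim r ->
  compat p q -> compat q r -> compat r p ->
  ~~ cyc3 p q r -> ~~ cyc3 p r q -> [set p; q; r] \in morse_complex K.
Proof.
move=> Pp Pq Pr pq qr rp c1 c2; rewrite inE; apply/andP; split.
  by apply/set0Pn; exists p; rewrite !inE eqxx.
apply/asboolP; split; last exact: acyclic3.
have touch a b s : compat a b -> occurs s a -> occurs s b -> a = b.
  case/orP=> [/eqP //|/and4P[]] ? ? ? ? [] -> [] /eqP;
  by do !match goal with H : is_true (~~ ?x) |- context [?x] => rewrite (negbTE H) end.
split=> [a|s a b _]; rewrite !inE; first by case/orP => [/orP[]|] /eqP->.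
case/orP=> [/orP[]|] /eqP->; case/orP=> [/orP[]|] /eqP-> // h1 h2;
  by [apply: touch h1 h2|apply/esym; apply: touch h2 h1].
Qed.

Lemma cyc3xx p q : cyc3 p p q = false. Proof. by rewrite /cyc3 eqxx. Qed.
Lemma cyc3xyx p q : cyc3 p q p = false.
Proof. by rewrite /cyc3 eqxx !andbF. Qed.

Lemma morse2 p q : prim p -> prim q -> compat p q ->
  [set p; q] \in morse_complex K.
Proof.
move=> Pp Pq pq; rewrite -(setUid [set p]).
by apply: morse3; rewrite ?compatxx ?cyc3xx ?cyc3xyx // compatC.
Qed.

Lemma morse1 p : prim p -> [set p] \in morse_complex K.
Proof. by move=> Pp; rewrite -(setUid [set p]) morse2 ?compatxx. Qed.

Lemma morse_prim (V : {set vec}) p : V \in morse_complex K -> p \in V -> prim p.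
Proof. by rewrite inE => /andP[_ /asboolP[[VP _] _]] /VP. Qed.

Lemma morse_compat (V : {set vec}) p q :
  V \in morse_complex K -> p \in V -> q \in V -> compat p q.
Proof.
move=> VM pV qV; have [p1 p2 _ _] := morse_prim VM pV.
move: VM; rewrite inE => /andP[_ /asboolP[[_ VU] _]].
rewrite /compat; case: eqP => //= npq; apply/and4P; split; apply/eqP => e;
  apply: npq; [apply: (VU p.1)|apply: (VU p.1)|apply: (VU p.2)|apply: (VU p.2)] => //;
  by rewrite /occurs -?e; tauto.
Qed.

(** A V-path needs a common dimension, which [cyc3] does not mention: each inclusion shows that the
    size of the bottoms does not increase, so around the cycle it is constant. *)
Lemma morse_no_cyc3 (V : {set vec}) p q r : V \in morse_complex K ->
  p \in V -> q \in V -> r \in V -> disj p q -> disj q r -> disj r p ->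
  ~~ cyc3 p q r.
Proof.
move=> VM pV qV rV pq qr rp; apply/negP => /and5P[n1 n2 n3 s1 /andP[s2 s3]].
have Pp := morse_prim VM pV; have Pq := morse_prim VM qV.
have Pr := morse_prim VM rV.
move: VM; rewrite inE => /andP[_ /asboolP[_ []]].
have lt a b : prim a -> prim b -> disj a b -> b.1 \subset a.2 ->
    b.1 \proper a.2 /\ (#|b.1| <= #|a.1|)%N.
  move=> Pa Pb /and4P[_ _ ne _] sub; have := prim_card Pa => ca.
  have pr : b.1 \proper a.2 by rewrite properEneq eq_sym ne.
  by split=> //; rewrite -ltnS -ca proper_card.
have [pr1 c1] := lt _ _ Pp Pq pq s1; have [pr2 c2] := lt _ _ Pq Pr qr s2.
have [pr3 c3] := lt _ _ Pr Pp rp s3.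
have eq : #|q.1| = #|p.1|.
  by apply/eqP; rewrite eqn_leq c1 (leq_trans c3).
have er : #|r.1| = #|p.1|.
  by apply/eqP; rewrite eqn_leq c3 (leq_trans c2) // eq.
exists 3, (fun i => nth p.1 [:: p.1; q.1; r.1] i),
  (fun i => nth set0 [:: p.2; q.2; r.2] i); split=> //.
exists (dim p.1); split=> [[|[|[|[|i]]]]|[|[|[|i]]]] //= _.
- by case: Pp.
- by rewrite /dim eq; case: Pq.
- by rewrite /dim er; case: Pr.
- by case: Pp.
- by case: (Pp) => _ ? _ ->; rewrite -surjective_pairing eq_sym.
- by case: (Pq) => _ ? _ ->; rewrite -surjective_pairing eq_sym /dim eq.
- by case: (Pr) => _ ? _ ->; rewrite -surjective_pairing eq_sym /dim er.
Qed.

End MorseSimplices.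

(* A local system on [L] is a family of fibres [val v] (sets of elements of a
   type [W]) with a transport [tr] along edges that is compatible with
   triangles. A non-empty [L] is connected and simply connected iff every local
   system with a non-empty fibre has a flat section. *)
Definition has_flat_sections (V : finType) (L : simplicial_complex V) : Prop :=
  forall (W : Type) (val : V -> W -> Prop) (tr : V -> V -> W -> W),
    (forall u v x, [set u; v] \in L -> val u x -> val v (tr u v x)) ->
    (forall u v w x, [set u; v; w] \in L -> val u x ->
       tr v w (tr u v x) = tr u w x) ->
  forall a e, [set a] \in L -> val a e ->
  exists h : V -> W, (forall u, [set u] \in L -> val u (h u)) /\
    (forall u v, [set u; v] \in L -> tr u v (h u) = h v).

Section Structures.
Variables (T : finType) (K : simplicial_complex T).

Definition is_edge (v w : T) : Prop :=
  [/\ v != w, vertices K = [set v; w] & [set v; w] \in K].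

(* Two disjoint edges, or a path with three edges if [w x] is an edge. *)
Definition is_path_like (v w x y : T) : Prop :=
  [/\ uniq [:: v; w; x; y], vertices K = [set v; w; x; y],
      [set v; w] \in K, [set x; y] \in K &
      forall s, s \in K -> (1 < #|s|)%N ->
        [\/ s = [set v; w], s = [set w; x] | s = [set x; y]]].

(* A 3-cycle, or a 2-simplex if [x y z] is a simplex. *)
Definition is_triangle_like (x y z : T) : Prop :=
  [/\ uniq [:: x; y; z], vertices K = [set x; y; z] &
      [/\ [set x; y] \in K, [set y; z] \in K & [set x; z] \in K]].

End Structures.

(** * Vertex-edge incidences and the filling of hollow triangles *)

Section LowVectors.
Variables (T : finType) (K : simplicial_complex T).
Local Notation vec := ({set T} * {set T})%type.
Implicit Types (p q r a b : vec) (u v w x y z : T) (s t : {set T}).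
Local Notation prim := (primitive_dvf K).

Definition adjacent u z := (u != z) && ([set u; z] \in K).

Local Notation adj := adjacent.

Lemma adjC u z : adj u z = adj z u.
Proof. by rewrite /adjacent eq_sym setUC. Qed.

Lemma adj_vertex u z : adj u z -> u \in vertices K.
Proof.
case/andP=> _ uz; rewrite inE; apply: simplex_face uz _ _.
  by rewrite sub1set !inE eqxx.
by apply/set0Pn; exists u; rewrite inE.
Qed.

Lemma sub_adj s u z : s \in K -> u \in s -> z \in s -> u != z -> adj u z.
Proof.
move=> Ks us zs nuz; rewrite /adjacent nuz; apply: simplex_face Ks _ _.
  by rewrite subUset !sub1set us.
by apply/set0Pn; exists u; rewrite !inE eqxx.
Qed.

Lemma sub_vertex s u : s \in K -> u \in s -> u \in vertices K.
Proof.
move=> Ks us; rewrite inE; apply: simplex_face Ks _ _; first by rewrite sub1set.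
by apply/set0Pn; exists u; rewrite inE.
Qed.

Definition low u z : vec := ([set u], [set u; z]).

Lemma prim_low u z : adj u z -> prim (low u z).
Proof.
move=> uz; have := adj_vertex uz; rewrite inE => Ku; case/andP: uz => nuz Kuz.
split=> //=; last by rewrite /dim cards2 cards1 nuz.
rewrite properEcard subsetUl /= cards2 cards1 nuz //.
Qed.

Lemma prim_eq_low p : prim p -> #|p.1| = 1%N ->
  exists u z, adj u z /\ p = low u z.
Proof.
move=> Pp c1; have c2 := prim_card Pp; have sub := prim_sub Pp.
have /eqP/cards1P[u e1] := c1; rewrite c1 in c2.
have : #|p.2 :\ u| = 1%N.
  by move: c2; rewrite (cardsD1 u) (fintype.subsetP sub) ?e1 ?inE ?eqxx //= => -[].
move/eqP/cards1P => [z ez].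
have e2 : p.2 = [set u; z].
  by rewrite -ez setD1K // (fintype.subsetP sub) // e1 inE.
have zu : z != u by have := set11 z; rewrite -ez !inE => /andP[].
exists u, z; split; last by rewrite [p]surjective_pairing e1 e2.
by rewrite /adjacent eq_sym zu -e2; case: Pp.
Qed.

Lemma disj_low_notin p u z : prim p -> u \notin p.2 -> disj (low u z) p.
Proof.
move=> Pp nu; have nu1 : u \notin p.1.
  by apply: contra nu; apply: (fintype.subsetP (prim_sub Pp)).
have ne s t : u \in s -> u \notin t -> s != t.
  by move=> us; apply: contraNneq => <-.
by rewrite /disj !ne // !inE eqxx.
Qed.

Lemma disj_low_low u z u' z' : u != z -> u' != z' ->
  disj (low u z) (low u' z') = (u != u') && ([set u; z] != [set u'; z']).
Proof.
move=> nuz nuz'; rewrite /disj /= (inj_eq set1_inj).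
have c1 x y y' : y != y' -> [set x] == [set y; y'] = false.
  by move=> ny; apply/eqP => /(congr1 (fun s => #|pred_of_set s|)); rewrite cards1 cards2 ny.
by rewrite c1 // [[set u; z] == [set u']]eq_sym c1.
Qed.

Lemma cyc3_card p q r : prim p -> prim q -> prim r ->
  disj p q -> disj q r -> disj r p -> cyc3 p q r ->
  #|q.1| = #|p.1| /\ #|r.1| = #|p.1|.
Proof.
move=> Pp Pq Pr pq qr rp /and5P[n1 n2 n3 s1 /andP[s2 s3]].
have lt a b : prim a -> disj a b -> b.1 \subset a.2 -> (#|b.1| <= #|a.1|)%N.
  move=> Pa /and4P[_ _ ne _] sub; rewrite -ltnS -(prim_card Pa) proper_card //.
  by rewrite properEneq eq_sym ne.
have c1 := lt _ _ Pp pq s1; have c2 := lt _ _ Pq qr s2; have c3 := lt _ _ Pr rp s3.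
by split; apply/eqP; rewrite eqn_leq ?c1 ?c3 ?(leq_trans c2) ?(leq_trans c3).
Qed.

Hypothesis no_iso : forall v, v \in vertices K -> exists z, adj v z.
Hypothesis not_triangle : forall x y z, ~ is_triangle_like K x y z.

(** If the bottoms have positive dimension, an edge inside [p.2] from [p.1] minus [q.1] to [q.1]
    minus [p.1] gives a vector whose dimension is too low to close up a V-path with the others. If
    they are vertices, [p], [q], [r] run around three edges; as [K] is not a triangle, some vertex
    lies off them, and any edge at that vertex will do. *)
Lemma fill_cyc3 p q r : prim p -> prim q -> prim r ->
  disj p q -> disj q r -> disj r p -> cyc3 p q r ->
  exists2 w, prim w & forall a b, a \in [:: p; q; r] -> b \in [:: p; q; r] ->
    [set a; w; b] \in morse_complex K.
Proof.
move=> Pp Pq Pr pq qr rp cyc.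
have [cq cr] := cyc3_card Pp Pq Pr pq qr rp cyc.
have [n1 n2 n3 s1 /andP[s2 s3]] := and5P cyc.
have L a : a \in [:: p; q; r] -> prim a.
  by rewrite !inE => /or3P[] /eqP->.
have C a b : a \in [:: p; q; r] -> b \in [:: p; q; r] -> compat a b.
  by rewrite /compat !inE => /or3P[] /eqP-> /or3P[] /eqP->; rewrite ?eqxx // ?[disj _ p]disjC ?[disj _ q]disjC
    ?pq ?qr ?rp ?orbT // disjC ?pq ?qr ?rp ?orbT.
have [c1|c1] := eqVneq #|p.1| 1%N; last first.
  have p1 : (1 < #|p.1|)%N by have := prim_gt0 Pp; case: #|p.1| c1 => [|[]].
  have /fintype.subsetPn[y yp yq] : ~~ (p.1 \subset q.1).
    by apply: contra n1 => sub; rewrite eqEcard sub cq leqnn.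
  have /fintype.subsetPn[z zq zp] : ~~ (q.1 \subset p.1).
    by apply: contra n1 => sub; rewrite eq_sym eqEcard sub cq leqnn.
  have nyz : y != z by apply: contraNneq zp => <-.
  have yp2 : y \in p.2 by apply: (fintype.subsetP (prim_sub Pp)).
  have zp2 : z \in p.2 by apply: (fintype.subsetP s1).
  have Kp2 : p.2 \in K by case: Pp.
  have yz := sub_adj Kp2 yp2 zp2 nyz.
  have Pw := prim_low yz; exists (low y z) => //.
  have card1 a : a \in [:: p; q; r] -> (1 < #|a.1|)%N.
    by rewrite !inE => /or3P[] /eqP->; rewrite ?cq ?cr.
  have D a : a \in [:: p; q; r] -> disj (low y z) a.
    move=> aL; have ca := card1 _ aL; have ca2 := prim_card (L _ aL).
    have ne s t : #|s| <> #|t| -> s != t by move=> h; apply/eqP => e; apply: h; rewrite e.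
    rewrite /disj /= (ne _ a.1) ?(ne _ a.2) ?(ne [set y; z] a.2) ?ca2 ?cards1 ?cards2 ?nyz /=;
      try by move: ca; case: #|a.1| => [|[|]].
    (* The one clash that sizes do not exclude is [[set y; z] = a.1]. The choice of [y] and [z]
       rules out [p.1] and [q.1]; for [r.1] it would make [r] and [p] a closed V-path of length
       2. *)
    rewrite andbT; apply/eqP => e; move: (aL); rewrite !inE => /or3P[] /eqP ea; subst a.
    - by move: zp; rewrite -e !inE eqxx orbT.
    - by move: yq; rewrite -e !inE eqxx.
    - have sub : r.1 \subset p.2 by rewrite -e subUset !sub1set yp2.
      exact: no_2cycle Pr Pp rp s3 sub.
  move=> a b aL bL; have aw := D _ aL; have bw := D _ bL.
  have [<-|nab] := eqVneq a b.
    rewrite (setUC [set a]) -setUA setUid.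
    by apply: morse2 Pw (L _ aL) _; apply: disj_compat.
  have ab : disj a b by have := C _ _ aL bL; rewrite /compat (negbTE nab).
  apply: (morse3 (L _ aL) Pw (L _ bL) _ (disj_compat bw) (C _ _ bL aL));
    first by rewrite compatC disj_compat.
    apply/negP => /(cyc3_card (L _ aL) Pw (L _ bL)); rewrite disjC => /(_ aw bw).
    by rewrite disjC => /(_ ab)[]; rewrite /= cards1 => e; have := card1 _ aL; rewrite -e.
  apply/negP => /(cyc3_card (L _ aL) (L _ bL) Pw ab).
  rewrite disjC => /(_ bw aw)[_].
  by rewrite /= cards1 => e; have := card1 _ aL; rewrite -e.
have [x1 [y1 [a1 e1]]] := prim_eq_low Pp c1.
have [x2 [y2 [a2 e2]]] := prim_eq_low Pq (etrans cq c1).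
have [x3 [y3 [a3 e3]]] := prim_eq_low Pr (etrans cr c1).
rewrite e1 e2 e3 /= !(inj_eq set1_inj) !sub1set !inE in n1 n2 n3 s1 s2 s3.
rewrite eq_sym (negbTE n1) /= in s1; rewrite eq_sym (negbTE n2) /= in s2.
rewrite eq_sym (negbTE n3) /= in s3.
move: s1 s2 s3 => /eqP s1 /eqP s2 /eqP s3; subst y1 y2 y3.
have [u uv nu] : exists2 u, u \in vertices K & u \notin [set x1; x2; x3].
  apply/fintype.subsetPn/negP => sub; apply: (@not_triangle x1 x2 x3); split.
  - by rewrite /= !inE negb_or n1 eq_sym n3 n2.
  - apply/eqP; rewrite eqEsubset sub /= !subUset !sub1set.
    by rewrite (adj_vertex a1) (adj_vertex a2) (adj_vertex a3).
  - by case/andP: a1; case/andP: a2; rewrite adjC in a3; case/andP: a3.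
have [z uz] := no_iso uv; have Pw := prim_low uz; exists (low u z) => //.
have U a : a \in [:: p; q; r] -> u \notin a.2.
  by move: nu; rewrite !inE !negb_or => /andP[/andP[? ?] ?] /or3P[] /eqP->;
    rewrite ?e1 ?e2 ?e3 /= !inE negb_or; apply/andP.
move=> a b aL bL; have aw := disj_low_notin z (L _ aL) (U _ aL).
have bw := disj_low_notin z (L _ bL) (U _ bL).
(* A closed V-path through [low u z] would need [u] in the top of [a] or of [b]. *)
apply: (morse3 (L _ aL) Pw (L _ bL) _ (disj_compat bw) (C _ _ bL aL));
    first by rewrite compatC disj_compat.
  by apply/negP => /and5P[_ _ _]; rewrite sub1set (negbTE (U _ aL)).
by apply/negP => /and5P[_ _ _ _ /andP[]]; rewrite sub1set (negbTE (U _ bL)).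
Qed.

End LowVectors.

Lemma subset2_eq (T : finType) (s : {set T}) (x y : T) :
  (1 < #|s|)%N -> s \subset [set x; y] -> s = [set x; y].
Proof.
move=> c sub; apply/eqP; rewrite eqEcard sub cards2 (leq_trans _ c) //.
by case: (_ != _).
Qed.

(** * Flat sections built from a hub vector *)

Section FlatSections.
Variables (T : finType) (K : simplicial_complex T).
Local Notation vec := ({set T} * {set T})%type.
Implicit Types (p q r a b : vec) (u v w x y z : T) (s t : {set T}).
Local Notation prim := (primitive_dvf K).
Local Notation adj := (adjacent K).

Lemma eq_set2 u z u' z' : [set u; z] = [set u'; z'] :> {set T} ->
  (u = u' /\ z = z') \/ (u = z' /\ z = u').
Proof.
move=> e; have hu : u \in [set u'; z'] by rewrite -e !inE eqxx.
have hz : z \in [set u'; z'] by rewrite -e !inE eqxx orbT.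
have hu' : u' \in [set u; z] by rewrite e !inE eqxx.
have hz' : z' \in [set u; z] by rewrite e !inE eqxx orbT.
move: hu hz hu' hz'; rewrite !inE.
by case/orP=> /eqP ?; case/orP=> /eqP ?; case/orP=> /eqP ?; case/orP=> /eqP ?;
  subst; tauto.
Qed.

Lemma touch_low u z u' z' : u != z -> u' != z' ->
  ~~ disj (low u z) (low u' z') -> u = u' \/ (u = z' /\ z = u').
Proof.
move=> nu nu'; rewrite disj_low_low // negb_and !negbK.
by case/orP=> /eqP; [left|move/eq_set2; tauto].
Qed.

Lemma disj_low_neq u z u' z' : u != z -> u' != z' ->
  disj (low u z) (low u' z') -> u <> u' /\ ~ (u = z' /\ z = u').
Proof.
move=> nu nu'; rewrite disj_low_low // => /andP[/eqP n1 /eqP n2]; split=> //.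
by case=> eu ez; apply: n2; rewrite eu ez setUC.
Qed.

(* A vertex is not joined to another one by two edges, so that four low
   vectors never touch each other in a cyclic pattern; hence two touching
   vectors are joined through the vectors disjoint from either. *)
Lemma low_connected (F : vec -> Prop) (Q : vec -> Prop) :
  (forall p, F p ->
     exists u z, [/\ adj u z, F (low u z) & disj p (low u z)]) ->
  (forall p q, F p -> F q -> disj p q -> Q p -> Q q) ->
  forall p q, F p -> F q -> Q p -> Q q.
Proof.
move=> wit step p q Fp Fq Qp.
have [u1 [z1 [a1 F1 d1]]] := wit _ Fp; have [u2 [z2 [a2 F2 d2]]] := wit _ Fq.
apply: (step _ _ F2 Fq); first by rewrite disjC.
have {Fp Qp d1} Q1 := step _ _ Fp F1 d1 Qp; have [/andP[n1 _] /andP[n2 _]] := (a1, a2).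
have [d12|d12] := boolP (disj (low u1 z1) (low u2 z2)); first exact: (step _ _ F1 F2).
have [u3 [z3 [/andP[n3 _] F3 d3]]] := wit _ F2.
have [u4 [z4 [/andP[n4 _] F4 d4]]] := wit _ F1.
have [d23|d23] := boolP (disj (low u1 z1) (low u3 z3)).
  by apply: (step _ _ F3 F2 _ (step _ _ F1 F3 d23 Q1)); rewrite disjC.
have [d24|d24] := boolP (disj (low u4 z4) (low u2 z2)).
  exact: (step _ _ F4 F2 d24 (step _ _ F1 F4 d4 Q1)).
have [d34|d34] := boolP (disj (low u4 z4) (low u3 z3)).
  apply: (step _ _ F3 F2 _ (step _ _ F4 F3 d34 (step _ _ F1 F4 d4 Q1))).
  by rewrite disjC.
have [e|/eqP ne12] := eqVneq (u1, z1) (u2, z2).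
  by case: e => e1 e2; move: Q1; rewrite e1 e2.
have {d3}[d3 d3'] := disj_low_neq n2 n3 d3.
have {d4}[d4 d4'] := disj_low_neq n1 n4 d4.
have := touch_low n1 n2 d12; have := touch_low n1 n3 d23.
have := touch_low n4 n2 d24; have := touch_low n4 n3 d34.
move/eqP: n1; move/eqP: n2; move/eqP: n3; move/eqP: n4 => n4 n3 n2 n1.
by move=> [?|[? ?]] [?|[? ?]] [?|[? ?]] [?|[? ?]]; exfalso; subst; tauto.
Qed.

Hypothesis no_iso : forall v, v \in vertices K -> exists z, adj v z.
Hypothesis not_triangle : forall x y z, ~ is_triangle_like K x y z.

(** The section is a value at [a], transported to each [b] through a vector compatible with both.
    The condition [conn] makes the intermediate vector immaterial; [ex2] provides a common one for
    both ends of an edge far from [a], so that flatness there is coherence of triangles. *)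
Lemma flat_sections_of_hub a : prim a ->
  (forall b, prim b -> ~~ compat a b ->
     exists p, [/\ prim p, disj a p & disj b p]) ->
  (forall b, prim b -> ~~ compat a b ->
     (forall p, prim p -> disj a p -> disj b p -> exists u z,
        [/\ adj u z, disj a (low u z), disj b (low u z) & disj p (low u z)]) \/
     (forall p q, prim p -> disj a p -> disj b p ->
        prim q -> disj a q -> disj b q -> p = q)) ->
  (forall b b', prim b -> prim b' -> ~~ compat a b -> ~~ compat a b' ->
     disj b b' -> exists p, [/\ prim p, disj a p, disj b p & disj b' p]) ->
  has_flat_sections (morse_complex K).
Proof.
move=> Pa ex1 conn ex2 W val tr valP cohM a0 e0.
have val_tr p q (x : W) : prim p -> prim q -> compat p q -> val p x -> val q (tr p q x).
  by move=> Pp Pq pq; apply: valP; apply: morse2.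
(* Coherence is given on simplices only; here it is extended to every pairwise compatible triple. If
   the triple forms a closed V-path, the three triangles through the vector [w] of [fill_cyc3]
   replace the missing one. *)
have coh p q r (x : W) : prim p -> prim q -> prim r ->
    compat p q -> compat q r -> compat p r -> val p x ->
    tr q r (tr p q x) = tr p r x.
  move=> Pp Pq Pr pq qr pr vx.
  have rp : compat r p by rewrite compatC.
  have fill (w : vec) : prim w -> (forall a b, a \in [:: p; q; r] -> b \in [:: p; q; r] ->
      [set a; w; b] \in morse_complex K) -> tr q r (tr p q x) = tr p r x.
    move=> Pw wM; have pL : p \in [:: p; q; r] by rewrite !inE eqxx.
    have qL : q \in [:: p; q; r] by rewrite !inE eqxx orbT.
    have rL : r \in [:: p; q; r] by rewrite !inE eqxx !orbT.
    rewrite -(cohM p w q) ?wM // (cohM w q r) 1?(setUC [set w]) ?wM // ?cohM ?wM //.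
    by apply: valP vx; apply: morse_face (wM p p pL pL) _ _;
      [rewrite -setUA setUS // sub1set !inE eqxx | apply/set0Pn; exists p; rewrite !inE eqxx].
  have cyc p' q' r' : cyc3 p' q' r' -> compat p' q' -> compat q' r' -> compat r' p' ->
      [/\ disj p' q', disj q' r' & disj r' p'].
    case/and5P=> n1 n2 n3 _ _.
    have ne (s t : vec) : s.1 != t.1 -> compat s t -> disj s t.
      by move=> n; rewrite /compat; case: (eqVneq s t) n => [->|_ _] //; rewrite eqxx.
    by split; apply: ne.
  have [c|c1] := boolP (cyc3 p q r).
    have [d1 d2 d3] := cyc _ _ _ c pq qr rp.
    have [w Pw wM] := fill_cyc3 no_iso not_triangle Pp Pq Pr d1 d2 d3 c.
    exact: fill Pw wM.
  have [c|c2] := boolP (cyc3 p r q).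
    have [|||d1 d2 d3] := cyc _ _ _ c _ _ _ => //; try by rewrite compatC.
    have [w Pw wM] := fill_cyc3 no_iso not_triangle Pp Pr Pq d1 d2 d3 c.
    have perm (b : vec) : b \in [:: p; q; r] -> b \in [:: p; r; q].
      by rewrite !inE => /or3P[] ->; rewrite ?orbT.
    by apply: (fill w Pw) => b b' /perm bL /perm bL'; apply: wM.
  by apply: cohM vx; apply: morse3.
move=> a0M va0.
have Pa0 : prim a0 by apply: morse_prim a0M _; rewrite inE.
have mid b : prim b -> exists p, [/\ prim p, compat a p & compat b p].
  move=> Pb; have [ab|nab] := boolP (compat a b).
    by exists b; rewrite compatxx.
  by have [p [Pp ap bp]] := ex1 _ Pb nab; exists p; rewrite !disj_compat.
(* The given value sits at an arbitrary [a0]; it is first moved to the hub. *)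
have [e ve] : exists e, val a e.
  have [p [Pp ap a0p]] := mid _ Pa0; exists (tr p a (tr a0 p e0)).
  by apply: val_tr (val_tr _ _ _ _ _ _ _) => //; rewrite compatC.
have indep b p q : prim b -> prim p -> prim q -> compat a p -> compat b p ->
    compat a q -> compat b q -> tr p b (tr a p e) = tr q b (tr a q e).
  move=> Pb Pp Pq ap bp aq bq; have [ab|nab] := boolP (compat a b).
    by rewrite !coh // compatC.
  have D r : compat a r -> compat b r -> disj a r /\ disj b r.
    rewrite /compat; case: eqP => [<-|_] /= ar.
      by move=> br; move: nab; rewrite compatC /compat br.
    by case: eqP => [eb|//]; move: nab; rewrite eb /compat ar orbT.
  have [dap dbp] := D _ ap bp; have [daq dbq] := D _ aq bq.
  have [wit|single] := conn _ Pb nab; last by rewrite (single p q).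
  pose F r := [/\ prim r, disj a r & disj b r].
  apply: (@low_connected F (fun q => tr p b (tr a p e) = tr q b (tr a q e)) _ _ p q) => //.
    move=> r [Pr ar br]; have [u [z [uz d1 d2 d3]]] := wit _ Pr ar br.
    by exists u, z; split=> //; split=> //; apply: prim_low.
  move=> r s [Pr ar br] [Ps as_ bs] rs ->.
  (* The triangles [a], [r], [s] and [r], [s], [b] carry the route through [r] to the route through
     [s]. *)
  rewrite -(coh a r s) ?(disj_compat rs) ?disj_compat //.
  rewrite (coh r s b) ?(disj_compat rs) // 1?compatC ?disj_compat // 1?disjC //.
  by apply: val_tr; rewrite ?disj_compat.
have /choice[f fP] : forall b, exists p, prim b -> [/\ prim p, compat a p & compat b p].
  move=> b; have [Pb|nPb] := pselect (prim b); last by exists b.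
  by have [p ?] := mid _ Pb; exists p.
exists (fun b => tr (f b) b (tr a (f b) e)); split=> [b bM|b b' bM].
  have Pb : prim b by apply: morse_prim bM _; rewrite inE.
  have [Pf af bf] := fP _ Pb.
  by apply: val_tr (val_tr _ _ _ _ _ _ _) => //; rewrite compatC.
have bV : b \in [set b; b'] by rewrite !inE eqxx.
have bV' : b' \in [set b; b'] by rewrite !inE eqxx orbT.
have Pb := morse_prim bM bV; have Pb' := morse_prim bM bV'.
have bb' := morse_compat bM bV bV'.
have [p [Pp ap bp b'p]] : exists p, [/\ prim p, compat a p, compat b p & compat b' p].
  have [ab|nab] := boolP (compat a b).
    by exists b; split=> //; [exact: compatxx|rewrite compatC].
  have [ab'|nab'] := boolP (compat a b').
    by exists b'; rewrite compatxx.
  have [eb|nb] := eqVneq b b'.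
    by subst b'; have [p [? ? ?]] := mid _ Pb; exists p.
  have [|p [? ? ? ?]] := ex2 _ _ Pb Pb' nab nab'.
    by move: bb'; rewrite /compat (negbTE nb).
  by exists p; rewrite !disj_compat.
have [Pf af bf] := fP _ Pb; have [Pf' af' bf'] := fP _ Pb'.
rewrite (indep b (f b) p) // (indep b' (f b') p) // coh // 1?compatC //.
exact: val_tr.
Qed.

End FlatSections.

(** * Choice of the hub and existence of witnesses *)

Section MorseCombinatorics.
Variables (T : finType) (K : simplicial_complex T).
Local Notation vec := ({set T} * {set T})%type.
Implicit Types (p q r a b : vec) (u v w x y z : T) (s t : {set T}).
Local Notation prim := (primitive_dvf K).
Local Notation adj := (adjacent K).

Lemma cards_neq s t : #|s| != #|t| -> s != t.
Proof. by apply: contraNneq => ->. Qed.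

Lemma in_neq u s t : u \in s -> u \notin t -> s != t.
Proof. by move=> us; apply: contraNneq => <-. Qed.

Lemma disj_low_avoid1 p u z y : prim p -> y \in p.1 -> u != y -> z != y ->
  disj (low u z) p.
Proof.
move=> Pp yp nu nz; have yp2 := fintype.subsetP (prim_sub Pp) _ yp.
have n1 : y \notin [set u] by rewrite inE eq_sym.
have n2 : y \notin [set u; z] by rewrite !inE negb_or eq_sym nu eq_sym.
by rewrite /disj /= ![_ == p.1]eq_sym ![_ == p.2]eq_sym !(in_neq yp) // !(in_neq yp2).
Qed.

Lemma disj_low_avoid2 p u z : prim p -> adj u z -> u \notin p.1 ->
  #|p.1| != 1%N -> disj (low u z) p.
Proof.
move=> Pp /andP[nuz _] nu c1; have := prim_gt0 Pp; have := prim_card Pp => c2 c0.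
rewrite /disj /= (in_neq (set11 u)) // (@in_neq u [set u; z] p.1) ?inE ?eqxx //=.
by rewrite !cards_neq // ?cards1 ?cards2 ?nuz ?c2; case: #|p.1| c0 c1 => [|[|]].
Qed.

Lemma disj_low_avoid3 p u z : prim p -> (2 < #|p.1|)%N -> disj (low u z) p.
Proof.
move=> Pp c1; have := prim_card Pp => c2.
by rewrite /disj /= !cards_neq // ?cards1 ?cards2 ?c2; case: #|p.1| c1 => [|[|[|]]] //; case: (u != z).
Qed.

(** Two forbidden starting vertices are enough in every dimension: the ends of [p.2] when [p.1] is a
    vertex, the ends of [p.1] when it is an edge. Beyond that nothing is forbidden, and [y] is
    repeated as a filler. *)
Lemma disj_low_vertices p : prim p -> exists y z0, forall u z, adj u z ->
  u != y -> u != z0 -> disj (low u z) p.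
Proof.
move=> Pp; have := prim_gt0 Pp.
have [c1 _|c1 c0] := eqVneq #|p.1| 1%N.
  have [y [z0 [_ e]]] := prim_eq_low Pp c1; exists y, z0 => u z _ ny nz.
  by apply: (disj_low_notin _ Pp); rewrite e /= !inE negb_or ny.
have [c2|c2] := eqVneq #|p.1| 2%N.
  have /cards2P[y [z0 [_ e]]] := introT eqP c2; exists y, z0 => u z uz ny nz.
  by apply: disj_low_avoid2; rewrite ?c2 // e !inE negb_or ny.
have /set0Pn[y _] : p.1 != set0 by rewrite -card_gt0.
exists y, y => u z _ _ _; apply: disj_low_avoid3 => //.
by case: #|p.1| c0 c1 c2 => [|[|[|]]].
Qed.

Lemma vec_extra p : prim p -> exists x y, [/\ x \in p.2, x \notin p.1 & y \in p.1].
Proof.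
move=> Pp; have /card_gt0P[y yp] := prim_gt0 Pp.
have /fintype.subsetPn[x xp nx] : ~~ (p.2 \subset p.1).
  by apply/negP => /subset_leq_card; rewrite (prim_card Pp) ltnn.
by exists x, y.
Qed.

(** The edge [xy] lies in [p.2] but not in [p.1], and it is smaller than [p.2]. Both directions are
    recorded because the leaf case must avoid a prescribed starting vertex. *)
Lemma high_disj_low p x y : prim p -> #|p.1| != 1%N ->
  x \in p.2 -> x \notin p.1 -> y \in p.1 ->
  [/\ adj x y, disj p (low x y) & disj p (low y x)].
Proof.
move=> Pp c1 xp nx yp; have nxy : x != y by apply: contraNneq nx => ->.
have xy : adj x y.
  by apply: (sub_adj (s := p.2)) => //; [case: Pp|apply: (fintype.subsetP (prim_sub Pp))].
have D := disj_low_avoid2 Pp xy nx c1; split=> //; rewrite disjC //.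
move: D; rewrite /disj /= => /and4P[_ _ D3 D4]; rewrite (setUC [set y]) D3 D4.
rewrite andbT !cards_neq // cards1 ?(prim_card Pp); last by rewrite eq_sym.
by case: #|p.1| (prim_gt0 Pp).
Qed.

Hypothesis no_iso : forall v, v \in vertices K -> exists z, adj v z.
Hypothesis not_edge : forall v w, ~ is_edge K v w.

(** By [low_connected] it suffices that each vector is disjoint from some incidence. This can fail
    only for an incidence [(y, yz)] that all others touch, and then there are no vertices besides
    [y] and [z]. *)
Lemma morse_graph_connected (Q : vec -> Prop) :
  (forall p q, prim p -> prim q -> disj p q -> Q p -> Q q) ->
  forall p q, prim p -> prim q -> Q p -> Q q.
Proof.
apply: (@low_connected _ K prim Q) => p Pp.
have [c1|c1] := eqVneq #|p.1| 1%N; last first.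
  have [x [y [xp nx yp]]] := vec_extra Pp; exists x, y.
  have [xy D _] := high_disj_low Pp c1 xp nx yp.
  by split=> //; apply: prim_low.
have [y [z [yz e]]] := prim_eq_low Pp c1; subst p; apply: contrapT => H.
have /andP[nyz Kyz] := yz.
apply: (@not_edge y z); split=> //; apply/eqP; rewrite eqEsubset.
rewrite subUset !sub1set (adj_vertex yz) (adj_vertex (etrans (adjC _ _ _) yz)) /= andbT.
apply/fintype.subsetP => u /no_iso[t ut]; rewrite !inE; have /andP[nut _] := ut.
have : ~~ disj (low y z) (low u t).
  by apply/negP => D; apply: H; exists u, t; split=> //; apply: prim_low.
by case/touch_low => // [->|[_ ->]]; rewrite eqxx ?orbT.
Qed.

Hypothesis not_path : forall v w x y, ~ is_path_like K v w x y.
Hypothesis not_triangle : forall x y z, ~ is_triangle_like K x y z.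

(** Only [low w v] clashes with the hub [low v w], so the condition on disjoint pairs of clashing
    vectors is vacuous. If some vector disjoint from both lacks a witness, then [K] is path-like,
    which is excluded, or a path with two edges, where there is just one such vector. *)
Lemma flat_sections_leaf v w : adj v w -> (forall z, adj v z -> z = w) ->
  has_flat_sections (morse_complex K).
Proof.
move=> vw leaf; have /andP[nvw Kvw] := vw.
have wv : adj w v by rewrite adjC.
have star s : s \in K -> v \in s -> s \subset [set v; w].
  move=> Ks vs; apply/fintype.subsetP => u us; rewrite !inE.
  have [//|nuv] := eqVneq u v; apply/eqP/leaf.
  by apply: sub_adj us _ => //; rewrite eq_sym.
have star2 p : prim p -> v \in p.2 -> p = low v w \/ p = low w v.
  move=> Pp vp; have Kp2 : p.2 \in K by case: Pp.
  have e2 : p.2 = [set v; w].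
    apply/eqP; rewrite eqEcard star //= (prim_card Pp) cards2 nvw.
    exact: prim_gt0 Pp.
  have c1 : #|p.1| = 1%N.
    by have := prim_card Pp; rewrite e2 cards2 nvw => -[].
  have [u [z [_ e]]] := prim_eq_low Pp c1; subst p.
  by case: (eq_set2 e2) => -[-> ->]; tauto.
have touch b : prim b -> ~~ compat (low v w) b -> b = low w v.
  move=> Pb; rewrite /compat negb_or => /andP[nb]; rewrite /disj !negb_and !negbK /=.
  have sub := prim_sub Pb => H.
  have vb : v \in b.2.
    case/or4P: H => /eqP e.
    - by apply: (fintype.subsetP sub); rewrite -e set11.
    - by rewrite -e set11.
    - by apply: (fintype.subsetP sub); rewrite -e !inE eqxx.
    - by rewrite -e !inE eqxx.
  by case: (star2 _ Pb vb) => // e; rewrite e eqxx in nb.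
have far p : prim p -> disj (low v w) p -> disj (low w v) p ->
    v \notin p.2 /\ p.1 != [set w].
  move=> Pp D1 D2; split; last by case/and4P: D2; rewrite eq_sym.
  apply/negP => vp; case: (star2 _ Pp vp) => e; subst p.
    by rewrite disj_irr in D1.
  by rewrite disj_irr in D2.
have farV p : prim p -> v \notin p.2 -> p.1 != [set w] ->
    disj (low v w) p /\ disj (low w v) p.
  move=> Pp vp pw; have vp1 : v \notin p.1.
    by apply: contra vp; apply: (fintype.subsetP (prim_sub Pp)).
  have ne s : v \in s -> (s != p.1) * (s != p.2) by move=> vs; rewrite !(in_neq vs).
  rewrite /disj /= !(ne [set v]) ?(ne [set v; w]) ?(ne [set w; v]) ?inE ?eqxx ?orbT //=.
  rewrite (eq_sym [set w] p.1) pw /=; split=> //.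
  rewrite cards_neq // cards1 (prim_card Pp); by case: #|p.1| (prim_gt0 Pp).
have farL u z : adj u z -> u != v -> u != w ->
    disj (low v w) (low u z) /\ disj (low w v) (low u z).
  move=> uz nuv nuw; apply: farV; first exact: prim_low.
    rewrite !inE negb_or eq_sym nuv; apply: contraNneq nuw => e.
    by apply/eqP/leaf; rewrite adjC e.
  by rewrite (inj_eq set1_inj).
have [u uV nu] : exists2 u, u \in vertices K & u \notin [set v; w].
  apply/fintype.subsetPn/negP => sub; apply: (@not_edge v w); split=> //.
  by apply/eqP; rewrite eqEsubset sub subUset !sub1set (adj_vertex vw) (adj_vertex wv).
move: nu; rewrite !inE negb_or => /andP[nuv nuw].
apply: (flat_sections_of_hub no_iso not_triangle (prim_low vw)).
- move=> b Pb /(touch _ Pb) ->; have [z uz] := no_iso uV.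
  have [D1 D2] := farL _ _ uz nuv nuw.
  by exists (low u z); split=> //; apply: prim_low.
- move=> b Pb /(touch _ Pb) -> {b Pb}.
  pose wit p := exists u z, [/\ adj u z, disj (low v w) (low u z),
    disj (low w v) (low u z) & disj p (low u z)].
  have [H|/existsNP[p]] := pselect (forall p, prim p -> disj (low v w) p ->
    disj (low w v) p -> wit p); first by left.
  move=> /not_implyP[Pp /not_implyP[D1 /not_implyP[D2 nwit]]]; right.
  have [vp pw] := far _ Pp D1 D2.
  have c1 : #|p.1| = 1%N.
    apply/eqP; apply: contra_notT nwit => c1.
    have [x [y [xp nx yp]]] := vec_extra Pp.
    have [xy d1 d2] := high_disj_low Pp c1 xp nx yp.
    have yp2 := fintype.subsetP (prim_sub Pp) _ yp.
    have nv (t : T) : t \in p.2 -> t != v by move=> tp; apply: contraNneq vp => <-.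
    (* Of the two directions of the edge, one that does not start at [w] is taken. *)
    have [xw|nxw] := eqVneq x w.
      have yx : adj y x by rewrite adjC.
      have nyw : y != w by rewrite -xw eq_sym; case/andP: xy.
      by have [] := farL _ _ yx (nv _ yp2) nyw; exists y, x.
    by have [] := farL _ _ xy (nv _ xp) nxw; exists x, y.
  have [y [z [yz e]]] := prim_eq_low Pp c1; subst p.
  have zy : adj z y by rewrite adjC.
  rewrite /= !inE negb_or (inj_eq set1_inj) in vp pw.
  have /andP[nvy nvz] := vp.
  (* An incidence starting off [v], [w] and [y] must touch [low y z], or it would be the missing
     witness. *)
  have only (t t' : T) : adj t t' -> t != v -> t != w -> t != y -> t = z /\ t' = y.
    move=> tt' ntv ntw nty; have [d1 d2] := farL _ _ tt' ntv ntw.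
    have : ~~ disj (low y z) (low t t').
      by apply/negP => d; apply: nwit; exists t, t'.
    have /andP[? _] := tt'; have /andP[? _] := yz.
    by case/touch_low => // [e|[-> ->//]]; rewrite e eqxx in nty.
  have [zw|nzw] := eqVneq z w; last first.
    case: (@not_path v w y z); split=> //.
    + rewrite /= !inE !negb_or nvw nvy nvz [w == y]eq_sym pw [w == z]eq_sym nzw.
      by have /andP[-> _] := yz.
    + apply/eqP; rewrite eqEsubset !subUset !sub1set (adj_vertex vw) (adj_vertex wv).
      rewrite (adj_vertex yz) (adj_vertex zy) /= andbT; apply/fintype.subsetP => t tV.
      rewrite !inE; have [t' tt'] := no_iso tV.
      have [//|ntv] := eqVneq t v; have [//|ntw] := eqVneq t w.
      have [//|nty] := eqVneq t y.
      by have [-> _] := only _ _ tt' ntv ntw nty; rewrite eqxx.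
    + by case/andP: yz.
    move=> s Ks c; have c2 x x' := @subset2_eq _ s x x' c.
    have [vs|nvs] := boolP (v \in s); first by apply/Or31/c2/star.
    have [zs|nzs] := boolP (z \in s).
      apply/Or33; rewrite (setUC [set y]); apply: c2; apply/fintype.subsetP => t ts.
      rewrite !inE; have [//|ntz] := eqVneq t z; apply/eqP.
      have zt : adj z t by apply: sub_adj Ks zs ts _; rewrite eq_sym.
      by have [] := only _ _ zt; rewrite // eq_sym //; case/andP: yz.
    apply/Or32/c2/fintype.subsetP => t ts; rewrite !inE.
    have [//|ntw] := eqVneq t w; have [//|nty] := eqVneq t y.
    have tv : t != v by apply: contraNneq nvs => <-.
    have [t' tt'] := no_iso (sub_vertex Ks ts).
    by have [e _] := only _ _ tt' tv ntw nty; rewrite -e ts in nzs.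
  (* Now [K] is the path [v], [w], [y], and [low y w] is the only vector away from the edge [vw] and
     from the vertex [w] as a bottom. *)
  subst z; have uniqF q : prim q -> disj (low v w) q -> disj (low w v) q -> q = low y w.
    move=> Pq d1 d2; have [vq qw] := far _ Pq d1 d2.
    have Kq : q.2 \in K by case: Pq.
    have sub : q.2 \subset [set y; w].
      apply/fintype.subsetP => t tq; rewrite !inE.
      have [//|nty] := eqVneq t y; have [//|ntw] := eqVneq t w.
      have tv : t != v by apply: contraNneq vq => <-.
      have [t' tt'] := no_iso (sub_vertex Kq tq).
      by have [e _] := only _ _ tt' tv ntw nty; rewrite e eqxx in ntw.
    have e2 : q.2 = [set y; w].
      apply/eqP; rewrite eqEcard sub cards2 pw (prim_card Pq); exact: prim_gt0 Pq.
    have c1q : #|q.1| = 1%N by have := prim_card Pq; rewrite e2 cards2 pw => -[].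
    have [x [x' [_ e]]] := prim_eq_low Pq c1q; subst q.
    by case: (eq_set2 e2) => -[ex ex'] //; [rewrite ex ex' | rewrite ex eqxx in qw].
  by move=> p q Pp' p1 p2 Pq q1 q2; rewrite (uniqF p) // (uniqF q).
- move=> b b' Pb Pb' /(touch _ Pb) -> /(touch _ Pb') ->.
  by rewrite disj_irr.
Qed.

(** Any incidence can be the hub. A vertex off three given ones exists, because three vertices with
    two neighbours each form a triangle. The claim [wit] then yields every condition on the hub,
    with [p] taken to be the hub itself, an arbitrary vector, or the second clashing vector. *)
Lemma flat_sections_nonleaf v w : adj v w ->
  (forall x y, adj x y -> exists2 z, adj x z & z != y) ->
  has_flat_sections (morse_complex K).
Proof.
move=> vw deg2; have /andP[nvw Kvw] := vw.
have four x y z : exists u, [/\ u \in vertices K, u != x, u != y & u != z].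
  suff /fintype.subsetPn[u uV] : ~~ (vertices K \subset [set x; y; z]).
    by rewrite !inE !negb_or => /andP[/andP[? ?] ?]; exists u.
  apply/negP => sub; have [w' vw' nw'] := deg2 _ _ vw.
  have wv : adj w v by rewrite adjC.
  have w'v : adj w' v by rewrite adjC.
  have nvw' : v != w' by case/andP: vw'.
  have e : [set v; w; w'] = vertices K.
    apply/eqP; rewrite eqEcard !subUset !sub1set.
    rewrite (adj_vertex vw) (adj_vertex wv) (adj_vertex w'v) /=.
    apply: leq_trans (subset_leq_card sub) _.
    have -> : #|[set v; w; w']| = 3.
      by rewrite -setUA cardsU1 cards2 !inE negb_or nvw nvw' eq_sym nw'.
    by rewrite -setUA cardsU1 cards2; case: (_ \notin _); case: (_ != _).
  apply: (@not_triangle v w w'); split=> //.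
    by rewrite /= !inE negb_or nvw nvw' eq_sym nw'.
  split=> //; last by case/andP: vw'.
  have [t wt nt] := deg2 _ _ wv; have := adj_vertex (etrans (adjC _ _ _) wt).
  rewrite -e !inE (negbTE nt) /=; case/orP => /eqP et; last by rewrite -et; case/andP: wt.
  by case/andP: wt; rewrite et eqxx.
have nbr u y : u \in vertices K -> exists2 z, adj u z & z != y.
  case/no_iso=> z uz; have [e|nzy] := eqVneq z y; last by exists z.
  by rewrite -e; apply: deg2.
have Pa := prim_low vw.
have wit b p : prim b -> ~~ compat (low v w) b -> prim p ->
    exists u z, [/\ adj u z, disj (low v w) (low u z), disj b (low u z) & disj p (low u z)].
  move=> Pb; rewrite /compat negb_or => /andP[_ H] Pp.
  rewrite /disj !negb_and !negbK /= in H.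
  (* If [b] starts at [v] like the hub, avoiding [v] at both ends handles the two of them and leaves
     two forbidden starting vertices for [p]. Otherwise the edge [vw] is [b.1] or [b.2]; starting
     off [v] and [w] handles the hub and [b], and avoiding one point of [p.1] at both ends handles
     [p]. *)
  have [eb|nb] := eqVneq [set v] b.1.
    have [y [z0 avoid]] := disj_low_vertices Pp.
    have [u [uV nuv nuy nuz]] := four v y z0; have [z uz nz] := nbr u v uV.
    exists u, z; split=> //; rewrite disjC; last exact: avoid.
      by apply: (@disj_low_avoid1 _ _ _ v Pa) => //; rewrite /= set11.
    by apply: (@disj_low_avoid1 _ _ _ v Pb) => //; rewrite -eb set11.
  have [x [y [_ _ yp]]] := vec_extra Pp.
  have [u [uV nuv nuw nuy]] := four v w y; have [z uz nz] := nbr u y uV.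
  have nu : u \notin [set v; w] by rewrite !inE negb_or nuv.
  exists u, z; split=> //; rewrite disjC; last exact: (@disj_low_avoid1 _ _ _ y Pp).
    exact: disj_low_notin Pa nu.
  rewrite (negbTE nb) /= in H; case/or3P: H => /eqP e.
  - have := prim_card Pb; rewrite -e cards1 => -[e0].
    by have := prim_gt0 Pb; rewrite -e0.
  - by apply: disj_low_avoid2; rewrite -?e ?cards2 ?nvw.
  - by apply: (disj_low_notin _ Pb); rewrite -e.
apply: (flat_sections_of_hub no_iso not_triangle Pa).
- move=> b Pb nb; have [u [z [uz d1 d2 _]]] := wit _ _ Pb nb Pa.
  by exists (low u z); split=> //; apply: prim_low.
- by move=> b Pb nb; left=> p Pp _ _; apply: wit.
- move=> b b' Pb Pb' nb _ _; have [u [z [uz d1 d2 d3]]] := wit _ _ Pb nb Pb'.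
  by exists (low u z); split=> //; apply: prim_low.
Qed.

Theorem morse_flat_sections : has_flat_sections (morse_complex K).
Proof.
move=> W val tr valP cohM a e aM.
have Pa : prim a by apply: morse_prim aM _; rewrite inE.
(* A vertex of the Morse complex supplies an edge of [K]; for an empty [K] there is nothing to
   prove. *)
have [x [y [xa _ _]]] := vec_extra Pa.
have Ka : a.2 \in K by case: Pa.
have [z xz] := no_iso (sub_vertex Ka xa).
have [deg2|/existsNP[v /existsNP[w /not_implyP[vw nvw]]]] :=
  pselect (forall x y, adj x y -> exists2 z, adj x z & z != y).
  exact: flat_sections_nonleaf xz deg2 _ _ _ valP cohM a e aM.
apply: (flat_sections_leaf vw _ valP cohM aM) => t vt; apply/eqP.
by apply: contra_notT nvw => nt; exists t.
Qed.

End MorseCombinatorics.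

(** * Recognizing the exceptional complexes *)

Section Isomorphisms.
Variables (T : finType) (K : simplicial_complex T).
Implicit Types (s : {set T}) (l : seq T).

(** An isomorphism in coordinates: the position of a vertex in [l] is its label in the model. *)
Definition spans n (F : seq (seq nat)) l : Prop :=
  [/\ uniq l, size l = n, vertices K =i l &
      forall s, s \subset vertices K -> (s \in K) =
        (s != set0) && has (fun f => [forall t in s, index t l \in f]) F].

(** The covering condition makes every label a vertex of the model, so an isomorphism can be
    inverted into an enumeration. The size is a successor because the map has to be total on [T],
    and [inord] needs a default label. *)
Lemma isomorphic_generatedP n F :
  (forall i, (i < n.+1)%N -> has (fun f => i \in f) F) ->
  isomorphic K (generated_complex n.+1 F) <-> exists l, spans n.+1 F l.
Proof.
move=> cover; have vL : vertices (generated_complex n.+1 F) = setT.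
  apply/setP => i; rewrite !inE; apply/andP; split.
    by apply/set0Pn; exists i; rewrite inE.
  have /hasP[f Ff fi] := cover i (ltn_ord i); apply/hasP; exists f => //.
  by apply/forall_inP => j; rewrite inE => /eqP->.
split=> [[f [finj fv fK]]|[l [ul sl vl lK]]].
  have /choice[g gP] : forall i, exists t, t \in vertices K /\ f t = i.
    move=> i; have : i \in f @: vertices K by rewrite fv vL inE.
    by case/imsetP=> t tV ->; exists t.
  have gK t : t \in vertices K -> g (f t) = t.
    by move=> tV; have [gV gf] := gP (f t); apply: finj gV tV gf.
  have ginj : injective g by move=> i j e; rewrite -[i](gP i).2 e (gP j).2.
  have ind t : t \in vertices K -> index t (map g (enum 'I_n.+1)) = f t.
    by move=> tV; rewrite -{1}(gK t tV) index_map // index_enum_ord.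
  exists (map g (enum 'I_n.+1)); split.
  - by rewrite map_inj_uniq ?enum_uniq.
  - by rewrite size_map size_enum_ord.
  - move=> t; apply/idP/mapP => [tV|[i _ ->]]; last by case: (gP i).
    by exists (f t); rewrite ?mem_enum ?gK.
  move=> s sV; rewrite fK // inE; congr (_ && _).
    by rewrite imset_eq0.
  apply: eq_has => F'; apply/forall_inP/forall_inP => H.
    by move=> t ts; rewrite ind ?(fintype.subsetP sV) //; apply/H/imset_f.
  by move=> i /imsetP[t ts ->]; rewrite /= -ind ?(fintype.subsetP sV) //; apply: H.
have ind t : t \in vertices K -> val (inord (index t l) : 'I_n.+1) = index t l.
  by move=> tV; rewrite /= inordK // -sl index_mem -vl.
exists (fun t => inord (index t l)); split.
- move=> t t' tV t'V /(congr1 val); rewrite !ind // => e.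
  by rewrite -(nth_index t (s := l) (x := t)) ?e ?nth_index -?vl.
- rewrite vL; apply/setP => i; rewrite inE; apply/imsetP.
  have il : (i < size l)%N by rewrite sl.
  have [t _] : exists2 t, t \in l & True by case: (l) il => // t l' _; exists t; rewrite ?inE ?eqxx.
  exists (nth t l i); first by rewrite vl mem_nth.
  by apply: val_inj; rewrite index_uniq // inord_val.
move=> s sV; rewrite lK // inE; congr (_ && _); first by rewrite imset_eq0.
apply: eq_has => F'; apply/forall_inP/forall_inP => H.
  by move=> i /imsetP[t ts ->]; rewrite ind ?(fintype.subsetP sV) //; apply: H.
by move=> t ts; rewrite -ind ?(fintype.subsetP sV) //; apply/H/imset_f.
Qed.

Lemma span_subset l (f : seq nat) (A s : {set T}) : vertices K =i l -> s \subset vertices K ->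
  (forall t, t \in l -> (index t l \in f) = (t \in A)) ->
  [forall t in s, index t l \in f] = (s \subset A).
Proof.
move=> vl sV fA; apply/forall_inP/fintype.subsetP => H t ts.
  by rewrite -fA ?H // -vl (fintype.subsetP sV).
by rewrite fA ?H // -vl (fintype.subsetP sV).
Qed.

Lemma has_cons' (U : Type) (P : pred U) a (l : seq U) : has P (a :: l) = P a || has P l.
Proof. by []. Qed.

Lemma face_in s t : t \in K -> s != set0 -> s \subset t -> s \in K.
Proof. by move=> Kt s0 st; apply: simplex_face Kt st s0. Qed.

Lemma simplex_sub_vertices s : s \in K -> s \subset vertices K.
Proof. by move=> Ks; apply/fintype.subsetP => t ts; apply: sub_vertex Ks ts. Qed.

Lemma small_simplex s : s \in K -> (#|s| <= 1)%N -> exists2 t, t \in vertices K & s = [set t].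
Proof.
move=> Ks c; have : #|s| == 1%N by rewrite eqn_leq c card_gt0 (simplex_neq0 Ks).
by case/cards1P=> t e; exists t => //; rewrite inE -e.
Qed.

Lemma isomorphic_edgeP : isomorphic K edge <-> exists v w, is_edge K v w.
Proof.
rewrite isomorphic_generatedP; last by case=> [|[|]].
split=> [[l [ul sl vl lK]]|[v [w [nvw vK Kvw]]]].
  case: l => [//|v [//|w [|]]] // in ul sl vl lK *.
  have nvw : v != w by move: ul; rewrite /= inE andbT.
  have vE : vertices K = [set v; w] by apply/setP => t; rewrite vl !inE.
  exists v, w; split=> //; rewrite lK ?vE // has_seq1 (@span_subset _ _ [set v; w]) //.
  - by rewrite subxx andbT; apply/set0Pn; exists v; rewrite !inE eqxx.
  - by rewrite vE.
  by move=> t; rewrite !inE /= => /orP[] /eqP->; rewrite ?eqxx ?(negbTE nvw) ?orbT.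
exists [:: v; w]; split=> //; first by rewrite /= inE nvw.
  by move=> t; rewrite vK !inE.
move=> s sV; rewrite has_seq1 (@span_subset _ _ [set v; w]) //.
- apply/idP/andP => [Ks|[s0 sub]]; last exact: face_in Kvw s0 sub.
  by rewrite -vK sV (simplex_neq0 Ks).
- by move=> t; rewrite vK !inE.
by move=> t; rewrite !inE /= => /orP[] /eqP->; rewrite ?eqxx ?(negbTE nvw) ?orbT.
Qed.

Lemma isomorphic_triangleP : isomorphic K three_cycle \/ isomorphic K two_simplex <->
  exists x y z, is_triangle_like K x y z.
Proof.
rewrite !isomorphic_generatedP; try by case=> [|[|[|]]].
have idx x y z (f : seq nat) (A : {set T}) : uniq [:: x; y; z] ->
   (0%N \in f) = (x \in A) -> (1%N \in f) = (y \in A) -> (2 \in f) = (z \in A) ->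
   forall t, t \in [:: x; y; z] -> (index t [:: x; y; z] \in f) = (t \in A).
  rewrite /= !inE negb_or => /andP[/andP[n1 n2] /andP[n3 _]] h0 h1 h2 t.
  rewrite !inE => /or3P[] /eqP->; rewrite ?eqxx ?(negbTE n1) ?(negbTE n2) ?(negbTE n3) //.
split=> [H|[x [y [z [u3 vK [xy yz xz]]]]]].
  (* Common to both models: any two labels lie in one generator. *)
  have [l [F [ul sl vl lK cov]]] : exists l (F : seq (seq nat)),
      [/\ uniq l, size l = 3, vertices K =i l,
      (forall s, s \subset vertices K -> (s \in K) =
        (s != set0) && has (fun f => [forall t in s, index t l \in f]) F) &
      forall i j, (i < j < 3)%N -> has (fun f => (i \in f) && (j \in f)) F].
    by case: H => -[l [ul sl vl lK]]; [exists l, [:: [:: 0; 1]; [:: 1; 2]; [:: 0; 2]]%N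
      |exists l, [:: [:: 0; 1; 2]]%N]; split=> // -[|[|[|i]]] [|[|[|j]]] // /andP[].
  case: l => [//|x [//|y [//|z [|]]]] // in ul sl vl lK *.
  have vE : vertices K = [set x; y; z] by apply/setP => t; rewrite vl !inE orbA.
  exists x, y, z; split=> //.
  have inK i j : (i < j < 3)%N -> [set nth x [:: x; y; z] i; nth x [:: x; y; z] j] \in K.
    move=> ij; have /andP[ij1 j3] := ij; have i3 := ltn_trans ij1 j3.
    have sub : [set nth x [:: x; y; z] i; nth x [:: x; y; z] j] \subset vertices K.
      by rewrite subUset !sub1set !vl !mem_nth.
    rewrite lK //; apply/andP; split.
      by apply/set0Pn; exists (nth x [:: x; y; z] i); rewrite !inE eqxx.
    have /hasP[f Ff /andP[fi fj]] := cov _ _ ij; apply/hasP; exists f => //.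
    by apply/forall_inP => t; rewrite !inE => /orP[] /eqP->; rewrite index_uniq.
  by split; [apply: (inK 0 1)%N|apply: (inK 1 2)%N|apply: (inK 0 2)%N].
have vl : vertices K =i [:: x; y; z] by move=> t; rewrite vK !inE orbA.
have := u3; rewrite /= !inE negb_or => /andP[/andP[n1 n2] /andP[n3 _]].
have N := (negbTE n1, negbTE n2, negbTE n3, eq_sym y x, eq_sym z x, eq_sym z y).
have [t|nt] := boolP ([set x; y; z] \in K).
  right; exists [:: x; y; z]; split=> // s sV; rewrite has_seq1.
  rewrite (@span_subset _ _ [set x; y; z]) //; last first.
    by apply: idx => //; rewrite !inE ?eqxx ?orbT.
  by rewrite -vK sV andbT; apply/idP/idP => [/simplex_neq0 //|s0]; apply: face_in t s0 _; rewrite -vK.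
left; exists [:: x; y; z]; split=> // s sV; rewrite 2!has_cons' has_seq1.
rewrite (@span_subset _ [:: 0; 1]%N [set x; y]) // ?(@span_subset _ [:: 1; 2]%N [set y; z]) //
  ?(@span_subset _ [:: 0; 2]%N [set x; z]) //.
- apply/idP/andP => [Ks|[s0 /or3P[]]]; try exact: face_in.
  split; first exact: simplex_neq0 Ks.
  (* As the full triangle is absent, every simplex misses a vertex and so lies in the opposite
     edge. *)
  have miss a : a \in [set x; y; z] -> a \notin s -> s \subset [set x; y; z] :\ a.
    by move=> aV nas; rewrite subsetD1 -vK sV.
  have [xs|xs] := boolP (x \in s); last first.
    apply/or3P/Or32/(fintype.subset_trans (miss x _ xs)); rewrite ?inE ?eqxx //.
    by apply/fintype.subsetP => t; rewrite !inE => /andP[/negbTE->].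
  have [ys|ys] := boolP (y \in s); last first.
    apply/or3P/Or33/(fintype.subset_trans (miss y _ ys)); rewrite ?inE ?eqxx ?orbT //.
    by apply/fintype.subsetP => t; rewrite !inE => /andP[/negbTE->]; rewrite orbF.
  have [zs|zs] := boolP (z \in s); last first.
    apply/or3P/Or31/(fintype.subset_trans (miss z _ zs)); rewrite ?inE ?eqxx ?orbT //.
    by apply/fintype.subsetP => t; rewrite !inE => /andP[/negbTE->]; rewrite orbF.
  case/negP: nt; apply: face_in Ks _ _; last by rewrite !subUset !sub1set xs ys.
  by apply/set0Pn; exists x; rewrite !inE eqxx.
- by apply: idx => //; rewrite !inE ?eqxx ?orbT ?N.
- by apply: idx => //; rewrite !inE ?eqxx ?orbT ?N.
- by apply: idx => //; rewrite !inE ?eqxx ?orbT ?N.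
Qed.

Lemma isomorphic_path_likeP : isomorphic K two_edges \/ isomorphic K path_three_edges <->
  exists v w x y, is_path_like K v w x y.
Proof.
rewrite !isomorphic_generatedP; try by case=> [|[|[|[|]]]].
(* The two models differ only in the middle edge, so a Boolean treats them together. *)
pose mid (b : bool) : seq (seq nat) := if b then [:: [:: 1; 2]]%N else [::].
have -> : (exists l, spans 4 [:: [:: 0; 1]; [:: 2; 3]]%N l) \/
    (exists l, spans 4 [:: [:: 0; 1]; [:: 1; 2]; [:: 2; 3]]%N l) <->
    exists b l, spans 4 ([:: 0; 1]%N :: mid b ++ [:: [:: 2; 3]])%N l.
  split=> [[[l lK]|[l lK]]|[[] [l lK]]]; [exists false|exists true|right|left];
    by exists l.
have idx v w x y (f : seq nat) (A : {set T}) : uniq [:: v; w; x; y] ->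
   (0%N \in f) = (v \in A) -> (1%N \in f) = (w \in A) ->
   (2 \in f) = (x \in A) -> (3 \in f) = (y \in A) ->
   forall t, t \in [:: v; w; x; y] -> (index t [:: v; w; x; y] \in f) = (t \in A).
  rewrite /= !inE !negb_or => /and4P[/and3P[n1 n2 n3] /andP[n4 n5] n6 _] h0 h1 h2 h3 t.
  rewrite !inE => /or4P[] /eqP->;
  by rewrite ?eqxx ?(negbTE n1) ?(negbTE n2) ?(negbTE n3) ?(negbTE n4) ?(negbTE n5) ?(negbTE n6).
have char v w x y b : uniq [:: v; w; x; y] -> vertices K =i [:: v; w; x; y] ->
    forall s, s \subset vertices K ->
    has (fun f => [forall t in s, index t [:: v; w; x; y] \in f])
      ([:: 0; 1]%N :: mid b ++ [:: [:: 2; 3]])%N =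
    [|| s \subset [set v; w], b && (s \subset [set w; x]) | s \subset [set x; y]].
  move=> u4 vl s sV; have u4' := u4; rewrite /= !inE !negb_or in u4'.
  have /and4P[/and3P[n1 n2 n3] /andP[n4 n5] n6 _] := u4'.
  have N := (negbTE n1, negbTE n2, negbTE n3, negbTE n4, negbTE n5, negbTE n6,
    (eq_sym w v, eq_sym x v, eq_sym y v, eq_sym x w, eq_sym y w, eq_sym y x)).
  rewrite has_cons' has_cat has_seq1.
  rewrite (@span_subset _ [:: 0; 1]%N [set v; w]) // ?(@span_subset _ [:: 2; 3]%N [set x; y]) //.
  - congr (_ || (_ || _)); case: b => //=; rewrite orbF.
    rewrite (@span_subset [:: v; w; x; y] [:: 1; 2]%N [set w; x]) //.
    by apply: idx => //; rewrite !inE ?eqxx ?orbT ?N.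
  - by apply: idx => //; rewrite !inE ?eqxx ?orbT ?N.
  - by apply: idx => //; rewrite !inE ?eqxx ?orbT ?N.
split=> [[b [l [ul sl vl lK]]]|[v [w [x [y [u4 vK Kvw Kxy sK]]]]]].
  case: l => [//|v [//|w [//|x [//|y [|]]]]] // in ul sl vl lK *.
  exists v, w, x, y; have chK := char _ _ _ _ b ul vl.
  have nz (t t' : T) : [set t; t'] != set0 by apply/set0Pn; exists t; rewrite !inE eqxx.
  split=> //.
  - by apply/setP => t; rewrite vl !inE !orbA.
  - by rewrite lK ?chK ?subxx ?nz // subUset !sub1set !vl !inE !eqxx ?orbT.
  - by rewrite lK ?chK ?subxx ?nz ?orbT // subUset !sub1set !vl !inE !eqxx ?orbT.
  move=> s Ks c; have sV := simplex_sub_vertices Ks.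
  move: Ks; rewrite lK // chK // => /andP[_ /or3P[|/andP[_]|]] /(subset2_eq c);
    by [apply: Or31|apply: Or32|apply: Or33].
have vl : vertices K =i [:: v; w; x; y] by move=> t; rewrite vK !inE !orbA.
exists ([set w; x] \in K), [:: v; w; x; y]; split=> // s sV; rewrite char //.
apply/idP/andP => [Ks|[s0 /or3P[|/andP[Kwx]|]]]; try exact: face_in.
split; first exact: simplex_neq0 Ks.
have [c|c] := leqP #|s| 1; last first.
  by case: (sK s Ks c) => e; move: Ks; rewrite e ?subxx ?orbT // => ->; rewrite ?orbT.
have [t tV e] := small_simplex Ks c; rewrite e !sub1set !inE.
by move: tV; rewrite vl !inE => /or4P[] ->; rewrite ?orbT.
Qed.

End Isomorphisms.

(** * Paths and homotopies *)

Local Open Scope classical_set_scope.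
Local Open Scope ring_scope.

Section RealFunctions.
Variables (R : realType).

(* [continuous] unfolds to a product, which hinders unification. *)
Definition cts (Y : topologicalType) (f : Y -> R) : Prop := continuous f.

Variable Y : topologicalType.
Implicit Types f g : Y -> R.

Lemma cts_cst (a : R) : cts (fun _ : Y => a).
Proof. by move=> y; exact: cvg_cst. Qed.

Lemma ctsD f g : cts f -> cts g -> cts (fun y => f y + g y).
Proof. by move=> cf cg y; apply: cvgD; [exact: cf|exact: cg]. Qed.

Lemma ctsN f : cts f -> cts (fun y => - f y).
Proof. by move=> cf y; apply: cvgN; exact: cf. Qed.

Lemma ctsB f g : cts f -> cts g -> cts (fun y => f y - g y).
Proof. by move=> cf cg; apply: ctsD => //; apply: ctsN. Qed.

Lemma ctsM f g : cts f -> cts g -> cts (fun y => f y * g y).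
Proof. by move=> cf cg y; apply: cvgM; [exact: cf|exact: cg]. Qed.

Lemma ctsmin f g : cts f -> cts g -> cts (fun y => Num.min (f y) (g y)).
Proof. by move=> cf cg y; apply: continuous_min; [exact: cf|exact: cg]. Qed.

Lemma ctsmax f g : cts f -> cts g -> cts (fun y => Num.max (f y) (g y)).
Proof. by move=> cf cg y; apply: continuous_max; [exact: cf|exact: cg]. Qed.

Lemma cts_comp (f : R -> R) g : cts f -> cts g -> cts (fun y => f (g y)).
Proof. by move=> cf cg y; apply: (continuous_comp (g := f)); [exact: cg|exact: cf]. Qed.

Lemma cts_comp2 (f : R * R -> R) g h : cts f -> cts g -> cts h ->
  cts (fun y => f (g y, h y)).
Proof.
move=> cf cg ch y; apply: (continuous_comp (f := fun y => (g y, h y)) (g := f)).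
  exact: (cvg_pair (cg y) (ch y)).
exact: cf.
Qed.

End RealFunctions.

Lemma cts_fst (R : realType) : cts (fun z : R * R => z.1).
Proof. by move=> z; exact: cvg_fst. Qed.

Lemma cts_snd (R : realType) : cts (fun z : R * R => z.2).
Proof. by move=> z; exact: cvg_snd. Qed.

Lemma cts_id (R : realType) : cts (fun z : R => z).
Proof. by move=> z; exact: cvg_id. Qed.

Ltac cts := repeat lazymatch goal with
  | |- cts (fun _ => ?a) => exact: cts_cst
  | |- cts (fun z => z) => exact: cts_id
  | |- cts (fun z => z.1) => exact: cts_fst
  | |- cts fst => exact: cts_fst
  | |- cts (fun z => z.2) => exact: cts_snd
  | |- cts snd => exact: cts_snd
  | |- cts (GRing.mul ?a) => change (cts (fun z => a * z))
  | |- cts (GRing.add ?a) => change (cts (fun z => a + z))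
  | |- cts (fun z => @?f z - @?g z) => apply: ctsB
  | |- cts (fun z => @?f z + @?g z) => apply: ctsD
  | |- cts (fun z => @?f z * @?g z) => apply: ctsM
  | |- cts (fun z => Num.min (@?f z) (@?g z)) => apply: ctsmin
  | |- cts (fun z => Num.max (@?f z) (@?g z)) => apply: ctsmax
  | |- _ => assumption
  end.

Lemma addKl (R : realType) (a b : R) : a + b - a = b.
Proof. by rewrite addrAC subrr add0r. Qed.

Section Clamp.
Variable R : realType.
Implicit Types (t a b : R).

Definition clamp a b t : R := Num.max a (Num.min b t).

Lemma clamp_le a b t : a <= b -> t <= a -> clamp a b t = a.
Proof. by move=> ab ta; rewrite /clamp max_l // ge_min ta orbT. Qed.

Lemma clamp_ge a b t : a <= b -> b <= t -> clamp a b t = b.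
Proof. by move=> ab bt; rewrite /clamp min_l // max_r. Qed.

Lemma clamp_id a b t : a <= t -> t <= b -> clamp a b t = t.
Proof. by move=> a_t tb; rewrite /clamp min_r // max_r. Qed.

Lemma clamp_itv a b t : a <= b -> (a <= clamp a b t) && (clamp a b t <= b).
Proof. by move=> ab; rewrite /clamp le_max lexx /= ge_max ab ge_min lexx. Qed.

Lemma cts_clamp (Y : topologicalType) a b (f : Y -> R) :
  cts f -> cts (fun y => clamp a b (f y)).
Proof. by move=> cf; rewrite /clamp; cts. Qed.

End Clamp.

Section IntervalInduction.
Variable R : realType.

(** Compactness of the unit interval, in the form used for all subdivision arguments. The supremum
    of the [t] with [P 0 t] cannot lie below 1, since the local hypothesis there carries [P] past
    it. *)
Lemma interval_induction (P : R -> R -> Prop) :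
  (forall a b c, 0 <= a -> a <= b -> b <= c -> c <= 1 -> P a b -> P b c -> P a c) ->
  (forall t, 0 <= t -> t <= 1 -> exists2 d, 0 < d & forall a b, 0 <= a -> a <= b ->
     b <= 1 -> t - d < a -> b < t + d -> P a b) ->
  P 0 1.
Proof.
move=> add loc; pose S := [set t | [/\ 0 <= t, t <= 1 & P 0 t]].
have S0 : S 0.
  split=> //; have [d d0 H] := loc 0 (lexx 0) ler01.
  by apply: H; rewrite ?lexx ?ler01 //; lra.
have hs : has_sup S by split; [exists 0|exists 1 => t []].
have s0 : 0 <= sup S by apply: sup_ubound => //; case: hs.
have s1 : sup S <= 1 by apply: ge_sup => [|t []]; first by exists 0.
have [d d0 H] := loc _ s0 s1.
have [t [t0 t1 Pt] lt] := sup_adherent d0 hs.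
have ts : t <= sup S by apply: sup_ubound; [case: hs|split].
(* Half of [d] past the supremum, cut off at 1: either the cut applies and [t'] is 1, or [t']
   exceeds the supremum. *)
set t' := Num.min 1 (sup S + d / 2).
have tt' : t <= t' by rewrite le_min t1; lra.
have t'1 : t' <= 1 by rewrite ge_min lexx.
have Pt' : P 0 t'.
  apply: add Pt _; rewrite ?lexx //; apply: H => //.
  by rewrite gt_min; apply/orP; right; lra.
have [le1|gt1] := leP 1 (sup S + d / 2).
  by move: Pt'; rewrite /t' min_l.
have : t' <= sup S.
  by apply: sup_ubound; [case: hs|split=> //; apply: le_trans t0 tt'].
by rewrite /t' min_r ?(ltW gt1) //; lra.
Qed.

End IntervalInduction.

Section Paths.
Variables (R : realType) (V : Type).
Local Notation E := (V -> R).
Variable A : E -> Prop.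
Implicit Types (f g h : R -> E).

Definition ctsE (Y : topologicalType) (F : Y -> E) : Prop :=
  forall v, cts (fun t : Y => F t v).

(* Paths and homotopies are parametrized by the whole line and the whole plane
   and are constant beyond the unit interval, resp. square: concatenation is
   then an algebraic formula, whose continuity is obvious. *)
Definition gpath (x y : E) f : Prop :=
  [/\ ctsE f, forall t, A (f t), forall t, t <= 0 -> f t = x &
      forall t, 1 <= t -> f t = y].

Definition homot (x y : E) f g : Prop := exists H : R * R -> E,
  [/\ ctsE H, forall z, A (H z), forall s t, t <= 0 -> H (s, t) = f s,
      forall s t, 1 <= t -> H (s, t) = g s &
      forall s t, (s <= 0 -> H (s, t) = x) /\ (1 <= s -> H (s, t) = y)].

Lemma ctsE_comp f (Y : topologicalType) (g : Y -> R) :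
  ctsE f -> cts g -> ctsE (fun t => f (g t)).
Proof. by move=> cf cg v; apply: cts_comp (cf v) cg. Qed.

Lemma ctsE_comp2 (F : R * R -> E) (Y : topologicalType) (g h : Y -> R) :
  ctsE F -> cts g -> cts h -> ctsE (fun t => F (g t, h t)).
Proof. by move=> cf cg ch v; apply: cts_comp2 (cf v) cg ch. Qed.

Lemma ctsE_compv f (Y : topologicalType) (g : Y -> R) v :
  ctsE f -> cts g -> cts (fun t => f (g t) v).
Proof. by move=> cf cg; apply: cts_comp (cf v) cg. Qed.

Lemma ctsE_comp2v (F : R * R -> E) (Y : topologicalType) (g h : Y -> R) v :
  ctsE F -> cts g -> cts h -> cts (fun t => F (g t, h t) v).
Proof. by move=> cf cg ch; apply: cts_comp2 (cf v) cg ch. Qed.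

Lemma homot_refl x y f : gpath x y f -> homot x y f f.
Proof.
move=> [cf Af f0 f1]; exists (fun z => f z.1); split=> //= [|s t].
  by apply: ctsE_comp => //; cts.
by split; [exact: f0|exact: f1].
Qed.

Lemma homot_sym x y f g : homot x y f g -> homot x y g f.
Proof.
move=> [H [cH AH H0 H1 Hxy]]; exists (fun z => H (z.1, 1 - z.2)).
split=> //= [|s t t0|s t t1]; first by apply: ctsE_comp2 => //; cts.
  by apply: H1; lra.
by apply: H0; lra.
Qed.

Lemma homot_trans x y f g h : homot x y f g -> homot x y g h -> homot x y f h.
Proof.
move=> [H [cH AH H0 H1 Hxy]] [G [cG AG G0 G1 Gxy]].
(* In each half of the square one of the two maps is stuck at [g]; subtracting [g] leaves the other,
   so no pasting of closed pieces is involved. *)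
pose L (z : R * R) : E := fun v => H (z.1, 2 * z.2) v + G (z.1, 2 * z.2 - 1) v - g z.1 v.
have Lle s t : t <= 1 / 2 -> L (s, t) = H (s, 2 * t).
  by move=> h2; apply/funext => v; rewrite /L /= (G0 s (2 * t - 1)); [exact: addrK|lra].
have Lge s t : 1 / 2 <= t -> L (s, t) = G (s, 2 * t - 1).
  by move=> h2; apply/funext => v; rewrite /L /= (H1 s (2 * t)); [exact: addKl|lra].
have cg : ctsE g.
  move=> v; rewrite (_ : (fun s => g s v) = (fun s => H (s, 1) v)); first by apply: ctsE_comp2v => //; cts.
  by apply/funext => s; rewrite H1.
exists L; split=> [v|[s t]|s t t0|s t t1|s t].
- apply: ctsB; first apply: ctsD.
  + by apply: ctsE_comp2v => //; cts.
  + by apply: ctsE_comp2v => //; cts.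
  + by apply: ctsE_compv => //; cts.
- by case: (lerP t (1 / 2)) => [/Lle|/ltW /Lge] ->.
- by rewrite Lle ?H0 //; lra.
- by rewrite Lge ?G1 //; lra.
by split=> hs; case: (lerP t (1 / 2)) => [/Lle|/ltW /Lge] ->;
  [apply: (Hxy _ _).1|apply: (Gxy _ _).1|apply: (Hxy _ _).2|apply: (Gxy _ _).2].
Qed.

Lemma homot_gpathl x y f g : homot x y f g -> gpath x y f.
Proof.
move=> [H [cH AH H0 H1 Hxy]]; have e s : f s = H (s, 0) by rewrite H0.
split=> [v|t|t ht|t ht]; rewrite ?e //; try by apply: (Hxy _ _).1.
  rewrite (_ : (fun s => f s v) = (fun s => H (s, 0) v)); first by apply: ctsE_comp2v => //; cts.
  by apply/funext => s; rewrite e.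
by apply: (Hxy _ _).2.
Qed.

(** At any time one of the two terms rests at the junction and cancels against [f 1]. *)
Definition concat f g : R -> E :=
  fun t v => f (2 * t) v + g (2 * t - 1) v - f 1 v.

Section Concat.
Variables x y z : E.

Lemma concat_le f g t : gpath x y f -> gpath y z g -> t <= 1 / 2 ->
  concat f g t = f (2 * t).
Proof.
move=> [_ _ _ f1] [_ _ g0 _] ht; apply/funext => v.
by rewrite /concat (f1 1 (lexx 1)) g0; [exact: addrK|lra].
Qed.

Lemma concat_ge f g t : gpath x y f -> gpath y z g -> 1 / 2 <= t ->
  concat f g t = g (2 * t - 1).
Proof.
move=> [_ _ _ f1] [_ _ g0 _] ht; apply/funext => v.
by rewrite /concat (f1 1 (lexx 1)) f1; [exact: addKl|lra].
Qed.

Lemma gpath_concat f g : gpath x y f -> gpath y z g -> gpath x z (concat f g).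
Proof.
move=> Pf Pg; have [cf Af f0 f1] := Pf; have [cg Ag g0 g1] := Pg.
split=> [v|t|t ht|t ht].
- apply: ctsB; first apply: ctsD.
  + by apply: ctsE_compv => //; cts.
  + by apply: ctsE_compv => //; cts.
  + exact: cts_cst.
- by case: (lerP t (1 / 2)) => ht; [rewrite (concat_le Pf Pg)|rewrite (concat_ge Pf Pg) ?ltW].
- by rewrite (concat_le Pf Pg) ?f0 //; lra.
- by rewrite (concat_ge Pf Pg) ?g1 //; lra.
Qed.

Lemma homot_concat f f' g g' : homot x y f f' -> homot y z g g' ->
  homot x z (concat f g) (concat f' g').
Proof.
move=> hf hg; have Pf := homot_gpathl hf; have Pg := homot_gpathl hg.
have Pf' := homot_gpathl (homot_sym hf); have Pg' := homot_gpathl (homot_sym hg).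
move: hf hg => [H [cH AH H0 H1 Hxy]] [G [cG AG G0 G1 Gxy]].
pose L (u : R * R) : E := fun v => H (2 * u.1, u.2) v + G (2 * u.1 - 1, u.2) v - y v.
have Lle s t : s <= 1 / 2 -> L (s, t) = H (2 * s, t).
  by move=> h2; apply/funext => v; rewrite /L /= (Gxy _ _).1; [exact: addrK|lra].
have Lge s t : 1 / 2 <= s -> L (s, t) = G (2 * s - 1, t).
  by move=> h2; apply/funext => v; rewrite /L /= (Hxy _ _).2; [exact: addKl|lra].
exists L; split=> [v|[s t]|s t t0|s t t1|s t].
- apply: ctsB; first apply: ctsD.
  + by apply: ctsE_comp2v => //; cts.
  + by apply: ctsE_comp2v => //; cts.
  + exact: cts_cst.
- by case: (lerP s (1 / 2)) => [/Lle|/ltW /Lge] ->.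
- case: (lerP s (1 / 2)) => hs; first by rewrite Lle // (concat_le Pf Pg) // H0.
  by rewrite Lge ?(ltW hs) // (concat_ge Pf Pg) ?(ltW hs) // G0.
- case: (lerP s (1 / 2)) => hs; first by rewrite Lle // (concat_le Pf' Pg') // H1.
  by rewrite Lge ?(ltW hs) // (concat_ge Pf' Pg') ?(ltW hs) // G1.
split=> hs; first by rewrite Lle ?(Hxy _ _).1 //; lra.
by rewrite Lge ?(Gxy _ _).2 //; lra.
Qed.

End Concat.

(* All groupoid laws come from convexity of the parameter domain. *)
Lemma homot_deform (F : R * R -> E) x y (a1 a2 b1 b2 : R -> R) :
  ctsE F -> (forall z, A (F z)) -> cts a1 -> cts a2 -> cts b1 -> cts b2 ->
  (forall s c, 0 <= c -> c <= 1 -> s <= 0 ->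
     F ((1 - c) * a1 s + c * b1 s, (1 - c) * a2 s + c * b2 s) = x) ->
  (forall s c, 0 <= c -> c <= 1 -> 1 <= s ->
     F ((1 - c) * a1 s + c * b1 s, (1 - c) * a2 s + c * b2 s) = y) ->
  homot x y (fun s => F (a1 s, a2 s)) (fun s => F (b1 s, b2 s)).
Proof.
move=> cF AF ca1 ca2 cb1 cb2 F0 F1.
pose c (z : R * R) := clamp 0 1 z.2.
have cc : cts c by apply: cts_clamp; cts.
have C (a : R -> R) : cts a -> cts (fun z : R * R => a z.1).
  by move=> ca; apply: cts_comp => //; cts.
have c01 z : 0 <= c z /\ c z <= 1 by apply/andP/clamp_itv/ler01.
exists (fun z => F ((1 - c z) * a1 z.1 + c z * b1 z.1, (1 - c z) * a2 z.1 + c z * b2 z.1)).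
split=> //= [|s t t0|s t t1|s t].
- by apply: (ctsE_comp2 cF); cts; apply: C.
- by rewrite /c /= clamp_le ?ler01 // subr0 !mul1r !mul0r !addr0.
- by rewrite /c /= clamp_ge ?ler01 // subrr !mul1r !mul0r !add0r.
by have [c0 c1] := c01 (s, t); split=> hs; [apply: F0|apply: F1].
Qed.

Lemma homot_reparam f x y (a b : R -> R) :
  ctsE f -> (forall t, A (f t)) -> cts a -> cts b ->
  (forall s c, 0 <= c -> c <= 1 -> s <= 0 -> f ((1 - c) * a s + c * b s) = x) ->
  (forall s c, 0 <= c -> c <= 1 -> 1 <= s -> f ((1 - c) * a s + c * b s) = y) ->
  homot x y (fun s => f (a s)) (fun s => f (b s)).
Proof.
move=> cf Af ca cb f0 f1.
apply: (@homot_deform (fun z => f z.1) x y a (fun=> 0) b (fun=> 0)) => //.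
  by apply: ctsE_comp => //; cts.
all: by cts.
Qed.

Lemma homot_path x y f (a b : R -> R) : gpath x y f -> cts a -> cts b ->
  (forall s, s <= 0 -> a s <= 0 /\ b s <= 0) ->
  (forall s, 1 <= s -> 1 <= a s /\ 1 <= b s) ->
  homot x y (fun s => f (a s)) (fun s => f (b s)).
Proof.
move=> [cf Af f0 f1] ca cb ab0 ab1; apply: homot_reparam => // s c c0 c1 hs.
  by apply: f0; have [] := ab0 _ hs; nra.
by apply: f1; have [] := ab1 _ hs; nra.
Qed.

Lemma gpath_cst x : A x -> gpath x x (fun=> x).
Proof. by move=> Ax; split=> // v; apply: cts_cst. Qed.

Lemma concat_cstl x y f : gpath x y f -> homot x y (concat (fun=> x) f) f.
Proof.
move=> Pf; have [cf Af f0 f1] := Pf.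
rewrite (_ : concat _ f = fun s => f (2 * s - 1)); last first.
  by apply/funext => s; apply/funext => v; rewrite /concat addrAC subrr add0r.
by apply: (@homot_path x y f (fun s => 2 * s - 1) (fun s => s)) => //; try cts;
  move=> s hs; lra.
Qed.

Definition rev f : R -> E := fun t => f (1 - t).

Lemma gpath_rev x y f : gpath x y f -> gpath y x (rev f).
Proof.
move=> [cf Af f0 f1]; split=> [|t|t ht|t ht].
- by apply: ctsE_comp => //; cts.
- exact: Af.
- by rewrite /rev f1 //; lra.
- by rewrite /rev f0 //; lra.
Qed.

Lemma concat_revl x y f : gpath x y f -> homot y y (concat (rev f) f) (fun=> y).
Proof.
move=> Pf; have [cf Af f0 f1] := Pf; have Pr := gpath_rev Pf.
(* Going back and forth is [f] after the absolute value of [2 * s - 1], written as a maximum, which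
   deforms linearly to the constant 1. *)
rewrite (_ : concat _ _ = fun s => f (Num.max (1 - 2 * s) (2 * s - 1))); last first.
  apply/funext => s; case: (lerP s (1 / 2)) => hs.
    by rewrite (concat_le Pr Pf) // max_l //; lra.
  by rewrite (concat_ge Pr Pf) ?ltW // max_r //; lra.
rewrite [X in homot _ _ _ X](_ : _ = fun=> f 1); last by apply/funext => s; rewrite f1.
apply: (@homot_reparam f y y (fun s => Num.max (1 - 2 * s) (2 * s - 1)) (fun=> 1)) => //;
  try cts; move=> s c c0 c1 hs; apply: f1;
  suff : 1 <= Num.max (1 - 2 * s) (2 * s - 1) by nra.
all: by rewrite le_max; apply/orP; [left; lra] || rewrite le_max; apply/orP; right; lra.
Qed.

Lemma concat_assoc x y z w f g h : gpath x y f -> gpath y z g -> gpath z w h ->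
  homot x w (concat (concat f g) h) (concat f (concat g h)).
Proof.
move=> Pf Pg Ph; have Pfg := gpath_concat Pf Pg; have Pgh := gpath_concat Pg Ph.
have P := gpath_concat Pf Pgh.
(* The left bracketing spends a quarter, a quarter and a half of the time, the right one a half, a
   quarter and a quarter. The change of time has slopes 2, 1, 1/2; being concave, it is the minimum
   of its linear pieces. *)
pose a (s : R) := Num.min (2 * s) (Num.min (s + 1 / 4) ((s + 1) / 2)).
rewrite [X in homot _ _ X _](_ : _ = fun s => concat f (concat g h) (a s)).
  apply: (@homot_path x w _ a (fun s => s)) => //; rewrite /a; try (by cts).
    by move=> s hs; rewrite !ge_min; split=> //; apply/orP; left; lra.
  by move=> s hs; rewrite !le_min; split=> //; apply/and3P; split; lra.
apply/funext => s; case: (lerP s (1 / 4)) => h1.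
  rewrite /a min_l; last by rewrite le_min; apply/andP; split; lra.
  rewrite (concat_le Pfg Ph) ?(concat_le Pf Pg) ?(concat_le Pf Pgh) //; lra.
case: (lerP s (1 / 2)) => h2.
  rewrite /a [Num.min (s + _) _]min_l ?min_r; [|lra|lra].
  rewrite (concat_le Pfg Ph h2) (concat_ge Pf Pg); last lra.
  rewrite (concat_ge Pf Pgh); last lra.
  by rewrite (concat_le Pg Ph); [congr g; lra|lra].
rewrite /a [Num.min (s + _) _]min_r ?min_r; [|lra|lra].
rewrite (concat_ge Pfg Ph) ?(ltW h2) // (concat_ge Pf Pgh); last lra.
by rewrite (concat_ge Pg Ph); [congr h; lra|lra].
Qed.

End Paths.

Lemma ptws_continuousP (R : realType) (V : finType) (Y : topologicalType)
    (F : Y -> {ptws V -> R}) :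
  continuous F <-> ctsE (fun y => F y : V -> R).
Proof.
split=> [cF v y|cF y].
  apply: (continuous_comp (f := F) (g := fun x : {ptws V -> R} => x v)); first exact: cF.
  exact: (@proj_continuous V (fun=> R) v).
apply/cvg_sup => v U.
have /= -> := @nbhsE (initial_topology (fun x : V -> R => x v)) (F y).
case=> B [[C oC <-] Cy] BU; apply: filterS BU _.
by apply: (cF v y); apply: open_nbhs_nbhs.
Qed.

(** * Straight-line paths and homotopies in the realization *)

Section Realization.
Variables (R : realType) (V : finType) (L : simplicial_complex V).
Local Notation E := (V -> R).
Implicit Types (x y z : E) (u v w : V) (s : {set V}).

Definition pointX (x : E) : Prop := geometric_realization R L x.

Definition supp (x : E) : {set V} := [set v | x v != 0]%SET.

Definition vertexE (u : V) : E := fun v => (v == u)%:R.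

Lemma supp_vertexE u : supp (vertexE u) = [set u]%SET.
Proof. by apply/setP => v; rewrite !inE /vertexE pnatr_eq0 eqb0 negbK. Qed.

Lemma pointX_vertexE u : ([set u] \in L)%SET -> pointX (vertexE u).
Proof.
move=> uL; split; last by rewrite -supp_vertexE in uL.
  by move=> v; rewrite /vertexE ler0n.
rewrite (bigD1 u) //= /vertexE eqxx big1 ?addr0 // => v /negbTE->; exact: mulr0n.
Qed.

Lemma pointX_ge0 x v : pointX x -> 0 <= x v. Proof. by case. Qed.

Lemma pointX_gt0 x v : pointX x -> (v \in supp x) = (0 < x v).
Proof. by move=> Xx; rewrite inE lt_def pointX_ge0 // andbT. Qed.

Lemma pointX_supp x : pointX x -> supp x \in L. Proof. by case. Qed.

Lemma pointX_ex x : pointX x -> exists u, u \in supp x.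
Proof. by move=> /pointX_supp /simplex_neq0 /set0Pn. Qed.

Lemma supp_vertex x u : pointX x -> u \in supp x -> ([set u] \in L)%SET.
Proof.
by move=> /pointX_supp Lx ux; have := sub_vertex Lx ux; rewrite inE.
Qed.

Lemma pointX_supp1 x u : pointX x -> supp x = [set u]%SET -> x = vertexE u.
Proof.
move=> [x0 x1 _] sx; have z v : v != u -> x v = 0.
  by move=> nvu; apply/eqP; apply: contraNT nvu => xv; rewrite -in_set1 -sx inE.
apply/funext => v; rewrite /vertexE; have [->|/z //] := eqVneq v u.
by rewrite -x1 (bigD1 u) //= big1 ?addr0 // => w /z.
Qed.

Lemma pointX_conv x y s c : pointX x -> pointX y -> s \in L ->
  supp x \subset s -> supp y \subset s -> 0 <= c -> c <= 1 ->
  pointX (fun v => (1 - c) * x v + c * y v).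
Proof.
move=> [x0 x1 xL] [y0 y1 yL] sL xs ys c0 c1.
have c1' : 0 <= 1 - c by rewrite subr_ge0.
split=> [v||].
- by rewrite addr_ge0 ?mulr_ge0.
- by rewrite big_split /= -!mulr_sumr x1 y1 !mulr1 subrK.
apply: simplex_face sL _ _.
  apply/fintype.subsetP => v; rewrite inE; apply: contraNT => vs.
  have z t : supp t \subset s -> t v = 0.
    by move=> /fintype.subsetP ts; apply/eqP; apply: contraNT vs => tv; apply: ts; rewrite inE.
  by rewrite !z ?mulr0 ?addr0.
have [c0'|nc] := eqVneq c 0.
  have /set0Pn[v] := simplex_neq0 xL; rewrite inE => xv; apply/set0Pn; exists v.
  by rewrite inE c0' subr0 mul1r mul0r addr0.
have /set0Pn[v] := simplex_neq0 yL; rewrite inE => yv; apply/set0Pn; exists v.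
rewrite inE gt_eqF // ltr_wpDl ?mulr_ge0 // mulr_gt0 // lt_def ?nc ?yv //=.
Qed.

Local Notation gpath := (gpath pointX).
Local Notation homot := (homot pointX).

Definition seg (x y : E) : R -> E :=
  fun t v => (1 - clamp 0 1 t) * x v + clamp 0 1 t * y v.

Lemma clamp01 (t : R) : 0 <= clamp 0 1 t /\ clamp 0 1 t <= 1.
Proof. by apply/andP/clamp_itv/ler01. Qed.

Lemma gpath_seg x y s : pointX x -> pointX y -> s \in L ->
  supp x \subset s -> supp y \subset s -> gpath x y (seg x y).
Proof.
move=> Xx Xy sL xs ys; split=> [v|t|t ht|t ht].
- have cc : cts (clamp 0 1 : R -> R) by apply: (@cts_clamp _ _ _ _ (fun t => t)); cts.
  by rewrite /seg; cts; apply: cts_clamp; cts.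
- by have [c0 c1] := clamp01 t; apply: pointX_conv sL _ _ _ _.
- by apply/funext => v; rewrite /seg clamp_le ?ler01 // subr0 mul1r mul0r addr0.
- by apply/funext => v; rewrite /seg clamp_ge ?ler01 // subrr mul1r mul0r add0r.
Qed.

Lemma supp_seg x y s t : supp x \subset s -> supp y \subset s ->
  supp (seg x y t) \subset s.
Proof.
move=> xs ys; apply/fintype.subsetP => v; rewrite inE; apply: contraNT => vs.
have z r : supp r \subset s -> r v = 0.
  by move=> /fintype.subsetP rs; apply/eqP; apply: contraNT vs => rv; apply: rs; rewrite inE.
by rewrite /seg !z ?mulr0 ?addr0.
Qed.

Lemma gpath_seg_vertex u x : pointX x -> u \in supp x ->
  gpath (vertexE u) x (seg (vertexE u) x).
Proof.
move=> Xx ux; apply: (gpath_seg _ _ (pointX_supp Xx)) => //.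
  by apply: pointX_vertexE; apply: supp_vertex ux.
by rewrite supp_vertexE sub1set.
Qed.

Lemma gpath_seg_edge u v : ([set u; v] \in L)%SET ->
  gpath (vertexE u) (vertexE v) (seg (vertexE u) (vertexE v)).
Proof.
move=> uv; have P w : w \in [set u; v]%SET -> pointX (vertexE w).
  by move=> wuv; have := sub_vertex uv wuv; rewrite inE => /pointX_vertexE.
by apply: (gpath_seg _ _ uv); first [apply: P|rewrite supp_vertexE sub1set];
  rewrite !inE eqxx ?orbT.
Qed.

(** The straight-line homotopy stays in the realization because at each time the two points share a
    simplex. *)
Lemma homot_contiguous x y f g : gpath x y f -> gpath x y g ->
  (forall t, exists2 s, s \in L & supp (f t) \subset s /\ supp (g t) \subset s) ->
  homot x y f g.
Proof.
move=> [cf Af f0 f1] [cg Ag g0 g1] fg.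
exists (fun (z : R * R) v => (1 - clamp 0 1 z.2) * f z.1 v + clamp 0 1 z.2 * g z.1 v).
split=> /= [v|[a t]|a t ht|a t ht|a t].
- have cc : cts (fun z : R * R => clamp 0 1 z.2) by apply: cts_clamp; cts.
  have ch (h : R -> E) : ctsE h -> cts (fun z : R * R => h z.1 v).
    by move=> chh; apply: ctsE_compv => //; cts.
  by cts; apply: ch.
- have [r rL [fr gr]] := fg a; have [c0 c1] := clamp01 t.
  exact: pointX_conv rL fr gr c0 c1.
- by apply/funext => v; rewrite clamp_le ?ler01 // subr0 mul1r mul0r addr0.
- by apply/funext => v; rewrite clamp_ge ?ler01 // subrr mul1r mul0r add0r.
by split=> ha; apply/funext => v; [rewrite f0 // g0 //|rewrite f1 // g1 //];
  rewrite -mulrDl subrK mul1r.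
Qed.

Lemma seg_triangle u v y : pointX y -> (v |: (u |: supp y) \in L)%SET ->
  homot (vertexE u) y (concat (seg (vertexE u) (vertexE v)) (seg (vertexE v) y))
    (seg (vertexE u) y).
Proof.
move=> Xy sL; set s := (v |: _)%SET in sL.
have us : supp (vertexE u) \subset s by rewrite supp_vertexE sub1set !inE eqxx !orbT.
have vs : supp (vertexE v) \subset s by rewrite supp_vertexE sub1set !inE eqxx.
have ys : supp y \subset s by rewrite /s setUA subsetUr.
have Xu : pointX (vertexE u).
  by apply: pointX_vertexE; have := @sub_vertex _ L s u sL; rewrite !inE eqxx orbT; apply.
have Xv : pointX (vertexE v).
  by apply: pointX_vertexE; have := @sub_vertex _ L s v sL; rewrite !inE eqxx; apply.
have P1 := gpath_seg Xu Xv sL us vs; have P2 := gpath_seg Xv Xy sL vs ys.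
apply: homot_contiguous (gpath_concat P1 P2) (gpath_seg Xu Xy sL us ys) _ => t.
exists s => //; split; last exact: supp_seg.
case: (lerP t (1 / 2)) => ht; first by rewrite (concat_le P1 P2) // supp_seg.
by rewrite (concat_ge P1 P2) ?ltW // supp_seg.
Qed.

End Realization.

(** * Simple connectivity from flat sections *)

Section PathsInRealization.
Variables (R : realType) (V : finType) (L : simplicial_complex V).
Local Notation E := (V -> R).
Local Notation pointX := (@pointX R V L).
Local Notation gpath := (gpath pointX).
Local Notation homot := (homot pointX).
Local Notation X := (geometric_realization R L).
Local Notation vertexE := (@vertexE R V).
Implicit Types (f g : R -> E) (u v w : V).

Lemma continuous_within (Y Z W : topologicalType) (D : set Z) (F : Z -> W) (g : Y -> Z) :
  {within D, continuous F} -> continuous g -> (forall y, D (g y)) ->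
  continuous (fun y => F (g y)).
Proof.
move=> /subspace_continuousP cF cg Dg y U FU.
have := cF _ (Dg y) U FU; rewrite nbhs_simpl /= => wU.
have := cg y _ wU; rewrite nbhs_simpl /=; apply: filterS => z; apply; exact: Dg.
Qed.

Lemma gpath_of_path (x y : E) (f : R -> {ptws V -> R}) : path_in X f x y ->
  gpath x y (fun t => f (clamp 0 1 t)).
Proof.
move=> [cf fX f0 f1].
have I t : [set` `[0, 1]] (clamp 0 1 t : R) by rewrite /= in_itv /= clamp_itv ?ler01.
split=> [||t ht|t ht].
- apply/ptws_continuousP; apply: (continuous_within cf _ I).
  by apply: (@cts_clamp _ _ _ _ (fun t => t)); exact: cts_id.
- by move=> t; apply: fX; exists (clamp 0 1 t).
- by rewrite clamp_le ?ler01.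
- by rewrite clamp_ge ?ler01.
Qed.

Lemma path_of_gpath (x y : E) f : gpath x y f -> path_in X f x y.
Proof.
move=> [cf Xf f0 f1]; split; [|by move=> _ [t _ <-]; apply: Xf|exact: f0|exact: f1].
by apply: continuous_subspaceT; apply/ptws_continuousP.
Qed.

Lemma path_homotopic_of_homot (x y : E) f g (f' g' : R -> {ptws V -> R}) :
  homot x y f g -> {in `[0, 1], f' =1 f} -> {in `[0, 1], g' =1 g} ->
  path_homotopic X f' g'.
Proof.
move=> fg ff gg; have [_ _ f0 f1] := homot_gpathl fg.
move: fg => [H [cH XH H0 H1 Hxy]]; exists H; split.
- by apply: continuous_subspaceT; apply/ptws_continuousP.
- by move=> _ [z _ <-]; apply: XH.
- by move=> s s01; rewrite H0 // H1 // ff // gg.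
move=> t t01; rewrite !ff ?in_itv /= ?lexx ?ler01 // f0 // f1 //.
by split; apply Hxy.
Qed.

Lemma homot_of_path_homotopic (x y : E) f g : gpath x y f -> gpath x y g ->
  path_homotopic X (f : R -> {ptws V -> R}) g -> homot x y f g.
Proof.
move=> [cf Xf f0 f1] [cg Xg g0 g1] [H [cH HX Hfg Hxy]].
pose c (t : R) : R := clamp 0 1 t.
have I t : c t \in `[0, 1] by rewrite in_itv /= clamp_itv ?ler01.
have cl t : t <= 0 -> c t = 0 by move=> ht; apply: clamp_le; rewrite ?ler01.
have cg' t : 1 <= t -> c t = 1 by move=> ht; apply: clamp_ge; rewrite ?ler01.
have fc h t : (forall t, t <= 0 -> h t = x) -> (forall t, 1 <= t -> h t = y) -> h (c t) = h t :> E.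
  move=> h0 h1; case: (lerP t 0) => ht; first by rewrite /c clamp_le ?ler01 // !h0.
  case: (lerP 1 t) => ht'; first by rewrite /c clamp_ge ?ler01 // !h1.
  by rewrite /c clamp_id ?ltW.
exists (fun z => H (c z.1, c z.2)).
have II (z : R * R) : ([set` `[0, 1]] `*` [set` `[0, 1]]) (c z.1, c z.2) by split; apply: I.
split=> /= [|z|s t ht|s t ht|s t].
- apply/ptws_continuousP; apply: (continuous_within cH _ II) => z.
  have c1 : cts (fun z : R * R => c z.1) by apply: cts_clamp; cts.
  have c2 : cts (fun z : R * R => c z.2) by apply: cts_clamp; cts.
  exact: (cvg_pair (c1 z) (c2 z)).
- by apply: HX; exists (c z.1, c z.2) => //; apply: II.
- by have [e _] := Hfg _ (I s); rewrite (cl _ ht) e fc.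
- by have [_ e] := Hfg _ (I s); rewrite (cg' _ ht) e fc.
have [e0 e1] := Hxy _ (I t).
by split=> hs; [rewrite (cl _ hs) e0 f0|rewrite (cg' _ hs) e1 f1].
Qed.

Definition piece f (s t : R) : R -> E := fun r => f (s + (t - s) * clamp 0 1 r).

Section Piece.
Variables (f : R -> E).
Hypotheses (cf : ctsE f) (Xf : forall t, pointX (f t)).

Lemma gpath_piece s t : gpath (f s) (f t) (piece f s t).
Proof.
split=> [|r|r hr|r hr]; last 1 first.
- by rewrite /piece clamp_ge ?ler01 // mulr1 addrC subrK.
- apply: ctsE_comp => //; cts.
  by apply: (@cts_clamp _ _ _ _ (fun t => t)); cts.
- exact: Xf.
- by rewrite /piece clamp_le ?ler01 // mulr0 addr0.
Qed.

(** Both sides are [f] after a change of parameter leading from [r] to [t], and such changes deform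
    linearly into each other; [s] need not lie between the ends. *)
Lemma piece_add r s t :
  homot (f r) (f t) (piece f r t) (concat (piece f r s) (piece f s t)).
Proof.
pose b (q : R) := r + (s - r) * clamp 0 1 (2 * q) + (t - s) * clamp 0 1 (2 * q - 1).
rewrite (_ : concat _ _ = fun q => f (b q)); last first.
  have P1 := gpath_piece r s; have P2 := gpath_piece s t.
  apply/funext => q; case: (lerP q (1 / 2)) => hq.
    rewrite (concat_le P1 P2) // /piece /b (clamp_le _ (_ : 2 * q - 1 <= 0)) ?ler01 ?mulr0 ?addr0 //.
    lra.
  rewrite (concat_ge P1 P2) ?ltW // /piece /b (clamp_ge _ (_ : 1 <= 2 * q)) ?ler01 //; last lra.
  by congr f; rewrite mulr1 (addrC r) subrK.
have cc : cts (fun q : R => clamp 0 1 q) by apply: (@cts_clamp _ _ _ _ (fun t => t)); cts.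
apply: homot_reparam => // [|||].
- by cts.
- by rewrite /b; cts; apply: cts_clamp; cts.
- move=> q c c0 c1 hq; rewrite /b !clamp_le ?ler01 //; [|lra|lra].
  by congr f; ring.
move=> q c c0 c1 hq; rewrite /b !clamp_ge ?ler01 //; [|lra|lra].
by congr f; ring.
Qed.

(* The star of [u] is a cone with apex [u]. *)
Lemma piece_star u s t : (forall r, u \in supp (piece f s t r)) ->
  homot (vertexE u) (f t) (concat (seg (vertexE u) (f s)) (piece f s t))
    (seg (vertexE u) (f t)).
Proof.
move=> star; set g := piece f s t.
have Pg : gpath (f s) (f t) g := gpath_piece s t; have [cg Xg g0 g1] := Pg.
pose F (z : R * R) : E := seg (vertexE u) (g z.1) z.2.
have cF : ctsE F.
  move=> v; rewrite /F /seg; cts; try by apply: cts_clamp; cts.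
  by apply: ctsE_compv => //; cts.
have XF z : pointX (F z).
  by have [_ + _ _] := gpath_seg_vertex (Xg z.1) (star z.1); apply.
have us : u \in supp (f s) by have := star 0; rewrite -/g g0.
have P1 := gpath_seg_vertex (Xf s) us.
(* In the coordinates of [F], position along [g] and height in the cone, the left side climbs at
   position 0 and then follows the top; the right side climbs at position 1. Clamping lets one
   linear formula describe both legs. *)
rewrite (_ : concat _ _ = fun q => F (2 * q - 1, 2 * q)); last first.
  apply/funext => q; case: (lerP q (1 / 2)) => hq.
    by rewrite (concat_le P1 Pg) // /F /= g0 //; lra.
  rewrite (concat_ge P1 Pg) ?ltW // /F /= /seg clamp_ge ?ler01 //; last lra.
  by apply/funext => v; rewrite subrr mul0r add0r mul1r.
rewrite (_ : seg _ (f t) = fun q => F (1, q)); last by rewrite /F /= g1.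
apply: (@homot_deform _ _ _ F _ _ (fun q => 2 * q - 1) (fun q => 2 * q) (fun=> 1) (fun q => q)) => //;
  try by cts.
  move=> q c c0 c1 hq; rewrite /F /seg /= clamp_le ?ler01 //; last nra.
  by apply/funext => v; rewrite subr0 mul1r mul0r addr0.
move=> q c c0 c1 hq; rewrite /F /seg /= clamp_ge ?ler01 //; last nra.
rewrite g1; last nra.
by apply/funext => v; rewrite subrr mul0r add0r mul1r.
Qed.

End Piece.

Hypothesis flat : has_flat_sections L.

(* Homotopy classes of paths from [a] form a local system; normal forms stand
   for the classes. *)
Definition nf (x y : E) f : R -> E := xget f [set g | homot x y f g].

Lemma nfP x y f : gpath x y f -> homot x y f (nf x y f).
Proof.
by move=> Pf; apply: (@xgetPex _ f [set g | homot x y f g]); exists f; apply: homot_refl.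
Qed.

Lemma nf_eq x y f g : homot x y f g -> nf x y f = nf x y g.
Proof.
move=> fg; have e : [set h | homot x y f h] = [set h | homot x y g h].
  apply/seteqP; split=> h /=; apply: homot_trans => //; exact: homot_sym.
(* The defaults [f] and [g] of [xget] differ, but the class is non-empty, so they are never
   returned. *)
rewrite /nf e /xget; case: pselect => // -[]; exists g; apply/asboolP.
exact: homot_refl (homot_gpathl (homot_sym fg)).
Qed.

Section Base.
Variable a : V.
Hypothesis aL : ([set a] \in L)%SET.

(** The fibre at [u] consists of the paths from [a] to [u], and transport appends an edge and
    normalizes. Its compatibility with triangles is associativity up to homotopy combined with
    [seg_triangle]. *)
Lemma flat_paths : exists h : V -> R -> E,
  (forall u, ([set u] \in L)%SET -> gpath (vertexE a) (vertexE u) (h u)) /\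
  (forall u v, ([set u; v] \in L)%SET ->
    homot (vertexE a) (vertexE v) (concat (h u) (seg (vertexE u) (vertexE v))) (h v)).
Proof.
pose val u f := gpath (vertexE a) (vertexE u) f.
pose cs u v f := concat f (seg (vertexE u) (vertexE v)).
pose tr u v f := nf (vertexE a) (vertexE v) (cs u v f).
have csP u v f : ([set u; v] \in L)%SET -> val u f -> val v (cs u v f).
  by move=> uv Pf; apply: gpath_concat Pf (gpath_seg_edge R uv).
have trP u v f : ([set u; v] \in L)%SET -> val u f -> homot (vertexE a) (vertexE v) (cs u v f) (tr u v f).
  by move=> uv Pf; apply/nfP/csP.
have valP u v f : ([set u; v] \in L)%SET -> val u f -> val v (tr u v f).
  by move=> uv Pf; apply: homot_gpathl (homot_sym (trP _ _ _ uv Pf)).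
have coh u v w f : ([set u; v; w] \in L)%SET -> val u f -> tr v w (tr u v f) = tr u w f.
  move=> uvw Pf; have face p q : p \in [set u; v; w]%SET -> q \in [set u; v; w]%SET -> ([set p; q] \in L)%SET.
    move=> hp hq; apply: simplex_face uvw _ _; first by rewrite subUset !sub1set hp.
    by apply/set0Pn; exists p; rewrite !inE eqxx.
  have uv : ([set u; v] \in L)%SET by apply: face; rewrite !inE eqxx ?orbT.
  have vw : ([set v; w] \in L)%SET by apply: face; rewrite !inE eqxx ?orbT.
  have wL : pointX (vertexE w).
    by apply: pointX_vertexE; rewrite -[[set w]%SET]setUid; apply: face; rewrite !inE eqxx ?orbT.
  apply: nf_eq; have Suv := gpath_seg_edge R uv; have Svw := gpath_seg_edge R vw.
  apply: homot_trans (homot_concat (homot_sym (trP _ _ _ uv Pf)) (homot_refl Svw)) _.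
  apply: homot_trans (concat_assoc Pf Suv Svw) _.
  apply: homot_concat (homot_refl Pf) _; apply: seg_triangle => //.
  by rewrite supp_vertexE setUA (setUC [set v]%SET).
have vala : val a (fun=> vertexE a) by apply/gpath_cst/pointX_vertexE.
have [h [hP hh]] := flat valP coh aL vala.
exists h; split=> // u v uv; rewrite -[h v](hh _ _ uv); apply: trP => //.
apply: hP; apply: simplex_face uv _ _; first by rewrite sub1set !inE eqxx.
by apply/set0Pn; exists u; rewrite inE.
Qed.

End Base.

(** The paths of [flat_paths], prolonged by a segment, give each point [y] a path from the base
    vertex that is unique up to homotopy. Following such a path by a piece of [f] gives again such a
    path; for a loop [f], cancellation then makes [f] null-homotopic. *)
Theorem simply_connected_of_flat : simply_connected R X.
Proof.
have main (x : E) : pointX x -> exists h : V -> R -> E, exists a,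
    [/\ forall u, ([set u] \in L)%SET -> gpath (vertexE a) (vertexE u) (h u),
    forall u y, pointX y -> u \in supp y ->
      gpath (vertexE a) y (concat (h u) (seg (vertexE u) y)) &
    forall u v y, pointX y -> u \in supp y -> v \in supp y ->
      homot (vertexE a) y (concat (h u) (seg (vertexE u) y))
        (concat (h v) (seg (vertexE v) y))].
  move=> Xx; have [a ax] := pointX_ex Xx.
  have [h [hP hh]] := flat_paths (supp_vertex Xx ax); exists h, a; split=> [//|u y Xy uy|u v y Xy uy vy].
    by apply: gpath_concat (hP _ (supp_vertex Xy uy)) (gpath_seg_vertex Xy uy).
  have uv : ([set u; v] \in L)%SET.
    apply: simplex_face (pointX_supp Xy) _ _; first by rewrite subUset !sub1set uy.
    by apply/set0Pn; exists u; rewrite !inE eqxx.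
  have Pu := hP _ (supp_vertex Xy uy).
  have Suv := gpath_seg_edge R uv; have Sv := gpath_seg_vertex Xy vy.
  apply: homot_sym; apply: homot_trans (homot_concat (homot_sym (hh _ _ uv)) (homot_refl Sv)) _.
  apply: homot_trans (concat_assoc Pu Suv Sv) _.
  apply: homot_concat (homot_refl Pu) _; apply: seg_triangle => //.
  rewrite (_ : _ |: _ = supp y)%SET ?pointX_supp //; apply/setP => w; rewrite !inE.
  by rewrite !inE in uy vy; case: eqP => [->|_] //=; case: eqP => [->|_].
split=> [x y Xx Xy|x f0 Xx /gpath_of_path].
  have [h [a [_ hP _]]] := main _ Xx.
  have [u ux] := pointX_ex Xx; have [v vy] := pointX_ex Xy.
  have P := gpath_concat (gpath_rev (hP _ _ Xx ux)) (hP _ _ Xy vy).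
  by eexists; apply: path_of_gpath P.
set f := fun t => f0 (clamp 0 1 t) => Pf; have [cf Xf fle fge] := Pf.
have [h [a [h0P hP hh]]] := main _ Xx.
pose G u y := concat (h u) (seg (vertexE u) y).
pose P s t := forall u v, u \in supp (f s) -> v \in supp (f t) ->
  homot (vertexE a) (f t) (concat (G u (f s)) (piece f s t)) (G v (f t)).
have P01 : P 0 1.
  apply: interval_induction => [r s t _ _ _ _ Prs Pst u w ur wt|t t0 t1].
    have [v vs] := pointX_ex (Xf s).
    have Pu := hP _ _ (Xf r) ur; have Pr := gpath_piece cf Xf r s.
    have Ps := gpath_piece cf Xf s t.
    apply: homot_trans (homot_concat (homot_refl Pu) (piece_add cf Xf r s t)) _.
    apply: homot_trans (homot_sym (concat_assoc Pu Pr Ps)) _.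
    by apply: homot_trans (homot_concat (Prs _ _ ur vs) (homot_refl Ps)) (Pst _ _ vs wt).
  (* On a short interval [f] stays in the open star of one vertex [u0], where [piece_star]
     applies. *)
  have [u0 u0t] := pointX_ex (Xf t).
  have [d d0 near] : exists2 d, 0 < d & forall s, t - d < s -> s < t + d -> u0 \in supp (f s).
    have gt0 : 0 < f t u0 by rewrite -(pointX_gt0 _ (Xf t)).
    have /nbhs_ballP[d d0 H] : nbhs t [set s | 0 < f s u0].
      exact: cvgr_gt (cf u0 t) _ gt0.
    exists d => // s s1 s2; rewrite (pointX_gt0 _ (Xf s)); apply: H.
    by rewrite /ball /= distrC ltr_distl s1 s2.
  exists d => // r s r0 rs s1 hr hs u v ur vs.
  have star q : u0 \in supp (piece f r s q).
    by have [c0 c1] := clamp01 q; apply: near; nra.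
  have u0r : u0 \in supp (f r) by apply: near => //; lra.
  have u0s : u0 \in supp (f s) by apply: near => //; lra.
  have Ps := gpath_piece cf Xf r s.
  have S := gpath_seg_vertex (Xf r) u0r.
  apply: homot_trans (homot_concat (hh _ _ _ (Xf r) ur u0r) (homot_refl Ps)) _.
  apply: homot_trans _ (hh _ _ _ (Xf s) u0s vs).
  have Ph := h0P _ (supp_vertex (Xf t) u0t).
  apply: homot_trans (concat_assoc Ph S Ps) _.
  by apply: homot_concat (homot_refl Ph) (piece_star cf Xf star).
have [u ux] := pointX_ex Xx; have PG := hP _ _ Xx ux.
have f_0 : f 0 = x by rewrite fle.
have f_1 : f 1 = x by rewrite fge.
have := P01 u u; rewrite f_0 f_1 => /(_ ux ux) hG.
have e : piece f 0 1 = f.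
  apply/funext => r; rewrite /piece subr0 mul1r add0r /f; congr f0.
  by have [c0 c1] := clamp01 r; rewrite clamp_id.
rewrite e in hG; have hf : homot x x f (fun=> x).
  have PR := gpath_rev PG.
  apply: homot_trans (homot_sym (concat_cstl Pf)) _.
  apply: homot_trans (homot_concat (homot_sym (concat_revl PG)) (homot_refl Pf)) _.
  apply: homot_trans (concat_assoc PR PG Pf) _.
  apply: homot_trans (homot_concat (homot_refl PR) hG) _.
  exact: concat_revl PG.
apply: path_homotopic_of_homot hf _ _ => //.
by move=> t; rewrite in_itv /= => /andP[t0 t1]; rewrite /f clamp_id.
Qed.

End PathsInRealization.

Lemma near_gt (R : realType) (Y : topologicalType) (f : Y -> R) y (a : R) :
  cts f -> a < f y -> \forall z \near y, a < f z.
Proof. by move=> cf ay; apply: (cvgr_gt (f y)) ay; exact: cf. Qed.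

Lemma near_lt (R : realType) (Y : topologicalType) (f : Y -> R) y (a : R) :
  cts f -> f y < a -> \forall z \near y, f z < a.
Proof. by move=> cf ay; apply: (cvgr_lt (f y)) ay; exact: cf. Qed.

(** * Connectedness of the realization *)

Section Connectedness.
Variables (R : realType) (V : finType) (L : simplicial_complex V).
Local Notation X := (geometric_realization R L).

Lemma connected_of_paths :
  (forall x y, X x -> X y -> exists f : R -> {ptws V -> R}, path_in X f x y) -> connected X.
Proof.
move=> paths; have [[x Xx]|nX] := pselect (exists x, X x); last first.
  rewrite (_ : X = classical_sets.set0); first exact: connected0.
  by apply/seteqP; split=> // x Xx; case: nX; exists x.
pose P (f : R -> {ptws V -> R}) := exists y, path_in X f x y.
have cP f : P f -> connected (f @` `[0, 1]).
  move=> [y [cf _ _ _]]; apply: connected_continuous_connected cf.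
  exact: segment_connected.
have cx f : P f -> (f @` `[0, 1]) x.
  by move=> [y [_ _ f0 _]]; exists 0; rewrite //= in_itv /= lexx ler01.
rewrite (_ : X = \bigcup_(f in P) (f @` `[0, 1])).
  by apply: bigcup_connected cP; exists x => f /cx.
apply/seteqP; split=> [y Xy|y [f [z [_ fX _ _]]] /fX //].
have [f pf] := paths _ _ Xx Xy; exists f; first by exists y.
by have [_ _ _ f1] := pf; exists 1; rewrite //= in_itv /= lexx ler01.
Qed.

Lemma connected_of_simply_connected : simply_connected R X -> connected X.
Proof. by case=> paths _; apply: connected_of_paths. Qed.

Lemma connected_of_graph :
  (forall Q : V -> Prop,
     (forall u v, ([set u; v] \in L)%SET -> Q u -> Q v) ->
     forall u v, ([set u] \in L)%SET -> ([set v] \in L)%SET -> Q u -> Q v) ->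
  connected X.
Proof.
move=> gc; apply: connected_of_paths => x y Xx Xy.
have [u ux] := pointX_ex Xx; have [v vy] := pointX_ex Xy.
have uL := supp_vertex Xx ux; have vL := supp_vertex Xy vy.
have [f Pf] : exists f, gpath (@pointX R V L) (vertexE R u) (vertexE R v) f.
  apply: (gc (fun v => exists f, gpath (@pointX R V L) (vertexE R u) (vertexE R v) f) _ u v) => //.
    move=> w w' ww' [f Pf]; exists (concat f (seg (vertexE R w) (vertexE R w'))).
    exact: gpath_concat Pf (gpath_seg_edge R ww').
  by exists (fun=> vertexE R u); apply/gpath_cst/pointX_vertexE.
have Px := gpath_rev (gpath_seg_vertex Xx ux).
have P := gpath_concat Px (gpath_concat Pf (gpath_seg_vertex Xy vy)).
by eexists; apply: path_of_gpath P.
Qed.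

End Connectedness.

(** * Double covers of the realization *)

Section Sections.
Variables (R : realType) (V : finType) (L : simplicial_complex V).
Local Notation E := (V -> R).
Local Notation pointX := (@pointX R V L).
Local Notation gpath := (gpath pointX).
Local Notation homot := (homot pointX).
Local Notation X := (geometric_realization R L).
Local Notation vertexE := (@vertexE R V).
Implicit Types (u v w : V).

Variable c : V -> V -> bool.
Hypothesis cocycle : forall s u v w, s \in L -> u \in s -> v \in s -> w \in s ->
  c u v (+) c v w = c u w.

(* A section, along [F], of the double cover of the realization defined by [c]. *)
Definition sec (Y : topologicalType) (F : Y -> E) (phi : Y -> V -> bool) : Prop :=
  (forall y u v, 0 < F y u -> 0 < F y v -> phi y v = phi y u (+) c u v) /\
  (forall y u, 0 < F y u -> \forall y' \near y, phi y' u = phi y u).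

Lemma sec_comp (Y Z : topologicalType) (F : Y -> E) phi (g : Z -> Y) :
  sec F phi -> continuous g -> sec (F \o g) (phi \o g).
Proof.
move=> [s1 s2] cg; split=> [z u v|z u /s2] /=; first exact: s1.
exact: cg.
Qed.

Lemma c_refl u : ([set u] \in L)%SET -> c u u = false.
Proof.
move=> uL; have := cocycle uL (set11 u) (set11 u) (set11 u).
by case: (c u u).
Qed.

Lemma near_itv (t : R) (P : R -> Prop) : (\forall s \near t, P s) ->
  exists2 d, 0 < d & forall s, t - d < s -> s < t + d -> P s.
Proof.
move=> /nbhs_ballP[d /= d0 H]; exists d => // s s1 s2; apply: H.
by rewrite /ball /= distrC ltr_distl s1 s2.
Qed.

Section Glue.
Variables (Y : topologicalType) (F F1 F2 : Y -> E) (phi1 phi2 : Y -> V -> bool).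
Variables (l : Y -> R) (b : R).
Hypotheses (cl : cts l) (XF : forall y, pointX (F y)) (cF : ctsE F).
Hypotheses (FF1 : forall y, l y <= b -> F y = F1 y).
Hypotheses (FF2 : forall y, b <= l y -> F y = F2 y).
Hypotheses (sec1 : sec F1 phi1) (sec2 : sec F2 phi2).
Hypothesis link : forall y y', l y = b -> l y' = b -> exists g : R -> Y,
  [/\ continuous g, g 0 = y, g 1 = y' & forall t, l (g t) = b].

Let d y u := phi1 y u (+) phi2 y u.

(** Passing from the chart [u] to the chart [v] changes both sections by [c u v], which cancels in
    the discrepancy [d]. *)
Lemma glue_indep y u v : l y = b -> 0 < F y u -> 0 < F y v -> d y u = d y v.
Proof.
move=> yb yu yv; rewrite /d.
rewrite (sec1.1 y u v) -?FF1 ?yb // (sec2.1 y u v) -?FF2 ?yb //.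
by case: (phi1 y u); case: (phi2 y u); case: (c u v).
Qed.

Lemma glue_const y y' u v : l y = b -> l y' = b -> 0 < F y u -> 0 < F y' v ->
  d y u = d y' v.
Proof.
move=> yb y'b yu yv; have [g [cg g0 g1 gb]] := link yb y'b.
pose P s t := forall u v, 0 < F (g s) u -> 0 < F (g t) v -> d (g s) u = d (g t) v.
have P01 : P 0 1; last by rewrite -g0 -g1; apply: P01; rewrite ?g0 ?g1.
have ex s : exists u, 0 < F (g s) u.
  by have [w ws] := pointX_ex (XF (g s)); exists w; rewrite -(pointX_gt0 _ (XF _)).
apply: interval_induction => [r s t _ _ _ _ Prs Pst w w' hr ht|t t0 t1].
  by have [z hs] := ex s; rewrite (Prs _ _ hr hs) (Pst _ _ hs ht).
have [u0 ht] := ex t.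
have n1 : \forall s \near t, phi1 (g s) u0 = phi1 (g t) u0.
  by apply: (cg t [set y | phi1 y u0 = phi1 (g t) u0]); apply: sec1.2; rewrite -FF1 ?gb.
have n2 : \forall s \near t, phi2 (g s) u0 = phi2 (g t) u0.
  by apply: (cg t [set y | phi2 y u0 = phi2 (g t) u0]); apply: sec2.2; rewrite -FF2 ?gb.
have n3 : \forall s \near t, 0 < F (g s) u0.
  by apply: (cg t [set y | 0 < F y u0]); apply: near_gt (@cF u0) ht.

have [e e0 He] := near_itv (filterI n1 (filterI n2 n3)).
exists e => // r s r0 rs s1 hr hs w w' wr ws.
have [|/=a1 [a2 a3]] := He r hr; first lra.
have [|/=b1 [b2 b3]] := He s _ hs; first lra.
by rewrite (glue_indep _ wr a3) ?gb // (glue_indep _ ws b3) ?gb // /d a1 a2 b1 b2.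
Qed.

(** [phi1] and [phi2] are sections over all of [Y], but along maps that agree with [F] on one side
    of the interface [l y = b] only. There they differ by a Boolean, constant since the interface is
    path-connected; flipping the second section by it makes them match. *)
Lemma sec_glue : exists phi, sec F phi.
Proof.
have [k kP] : exists k, forall y u, l y = b -> 0 < F y u -> phi2 y u (+) k = phi1 y u.
  (* With an empty interface either value of [k] works. *)
  have [[y0 y0b]|no] := pselect (exists y, l y = b); last first.
    by exists false => y u yb; case: no; exists y.
  have [u0] := pointX_ex (XF y0); rewrite (pointX_gt0 _ (XF _)) => u0y.
  exists (d y0 u0) => y u yb yu; rewrite (glue_const y0b yb u0y yu) /d.
  by case: (phi1 y u); case: (phi2 y u).
exists (fun y u => if l y <= b then phi1 y u else phi2 y u (+) k); split=> [y u v|y u].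
  case: (lerP (l y) b) => [yb|/ltW yb].
    by rewrite (FF1 yb); apply: sec1.1.
  rewrite (FF2 yb) => yu yv; rewrite (sec2.1 y u v yu yv).
  by case: (phi2 y u); case: (c u v); case: k {kP}.
move=> yu; case: (ltgtP (l y) b) => yb.
- have n1 : \forall y' \near y, l y' < b by apply: near_lt (@cl) yb.
  have n2 : \forall y' \near y, phi1 y' u = phi1 y u by apply: sec1.2; rewrite -FF1 ?ltW.
  by apply: filterS2 n1 n2 => y' h1 h2; rewrite ltW.
- have n1 : \forall y' \near y, b < l y' by apply: near_gt (@cl) yb.
  have n2 : \forall y' \near y, phi2 y' u = phi2 y u by apply: sec2.2; rewrite -FF2 ?ltW.
  by apply: filterS2 n1 n2 => y' h1 h2; rewrite leNgt h1 /= h2.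
have n1 : \forall y' \near y, phi1 y' u = phi1 y u by apply: sec1.2; rewrite -FF1 ?yb.
have n2 : \forall y' \near y, phi2 y' u = phi2 y u by apply: sec2.2; rewrite -FF2 ?yb.
apply: filterS2 n1 n2 => y' h1 h2; case: ifP => // _.
by rewrite h2 kP.
Qed.

End Glue.

Lemma sec_ext (Y : topologicalType) (F G : Y -> E) phi :
  (forall y, F y = G y) -> sec F phi -> sec G phi.
Proof. by move=> FG; rewrite (_ : F = G) //; apply/funext. Qed.

Section Square.
Variable F : R * R -> E.
Hypotheses (cF : ctsE F) (XF : forall z, pointX (F z)).

(** Clamping extends the restriction to a rectangle back to the plane, so that [sec_glue] applies
    without subspaces. *)
Definition box (a b e d : R) (z : R * R) := F (clamp a b z.1, clamp e d z.2).

Lemma cts_box a b e d : ctsE (box a b e d).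
Proof. by apply: ctsE_comp2 => //; apply: cts_clamp; cts. Qed.

Lemma clamp_clamp (a b a' b' t : R) : a <= a' -> a' <= b' -> b' <= b ->
  clamp a b (clamp a' b' t) = clamp a' b' t.
Proof.
move=> aa ab bb; have /andP[h1 h2] := clamp_itv t ab.
by rewrite clamp_id //; [apply: le_trans h1|apply: le_trans bb].
Qed.

Lemma clamp_l (a b d t : R) : a <= b -> b <= d -> t <= b -> clamp a d t = clamp a b t.
Proof.
by move=> ab bd tb; rewrite /clamp !min_r // (le_trans tb).
Qed.

Lemma clamp_r (a b d t : R) : a <= b -> b <= d -> b <= t -> clamp a d t = clamp b d t.
Proof.
move=> ab bd bt; rewrite /clamp !max_r // le_min ?bd ?bt //.
by rewrite (le_trans ab) ?(le_trans ab bt).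
Qed.

Lemma pair_continuous (Y : topologicalType) (f g : Y -> R) : cts f -> cts g ->
  continuous (fun y => (f y, g y)).
Proof. by move=> cf cg y; exact: (cvg_pair (cf y) (cg y)). Qed.

Lemma sec_box_narrow a b e d e' d' phi : e' <= e -> e <= d -> d <= d' ->
  sec (box a b e' d') phi -> exists phi', sec (box a b e d) phi'.
Proof.
move=> h1 h2 h3 sp; exists (phi \o fun z => (z.1, clamp e d z.2)).
apply: sec_ext (sec_comp sp _); last first.
  by apply: pair_continuous; [cts|apply: cts_clamp; cts].
by move=> z; rewrite /box /= clamp_clamp.
Qed.

(** Gluing proceeds along the first coordinate, the height shrinking to the smaller of the two. Near
    [(t, y)] some coordinate [u0] stays positive, and there [c u0] is itself a section, by the
    cocycle identity. *)
Lemma sec_strip y : exists2 d, 0 < d & exists phi, sec (box 0 1 (y - d) (y + d)) phi.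
Proof.
apply: (@interval_induction _ (fun a b =>
  exists2 d, 0 < d & exists phi, sec (box a b (y - d) (y + d)) phi)).
  move=> r s t _ rs st _ [d1 d10 [phi1 sec1]] [d2 d20 [phi2 sec2]].
  have [d0 hd1 hd2] : [/\ 0 < Num.min d1 d2, Num.min d1 d2 <= d1 & Num.min d1 d2 <= d2].
    by rewrite lt_min d10 d20 !ge_min !lexx orbT.
  set d := Num.min d1 d2 in d0 hd1 hd2; exists d => //.
  have [|||psi1 {}sec1] := sec_box_narrow _ _ _ sec1 (e := y - d) (d := y + d); try lra.
  have [|||psi2 {}sec2] := sec_box_narrow _ _ _ sec2 (e := y - d) (d := y + d); try lra.
  apply: (sec_glue (l := fst) (b := s) _ _ _ _ _ sec1 sec2) => [|||z hz|z hz|z z' hz hz'] //.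
  - exact: cts_fst.
  - by move=> z; apply: XF.
  - exact: cts_box.
  - by rewrite /box (clamp_l _ _ hz).
  - by rewrite /box (clamp_r _ _ hz).
  exists (fun t => (s, (1 - t) * z.2 + t * z'.2)); split=> //.
  - by apply: pair_continuous; cts.
  - by case: z hz => ? ? /= ->; rewrite subr0 mul1r mul0r addr0.
  - by case: z' hz' => ? ? /= ->; rewrite subrr mul1r mul0r add0r.
move=> t t0 t1; have [u0 ut] := pointX_ex (XF (t, y)).
rewrite (pointX_gt0 _ (XF _)) in ut.
have /nbhs_ballP[d /= d0 H] : nbhs (t, y) [set z | 0 < F z u0].
  exact: near_gt (@cF u0) ut.
(* Half of the radius keeps the closed strip inside the open ball. *)
have d20 : 0 < d / 2 by lra.
exists d => // a b a0 ab b1 ha hb; exists (d / 2) => //; exists (fun _ u => c u0 u).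
have pos z : 0 < box a b (y - d / 2) (y + d / 2) z u0.
  apply: H; have /andP[h1 h2] := clamp_itv z.1 ab.
  have /andP[h3 h4] : (y - d / 2 <= clamp (y - d / 2) (y + d / 2) z.2) &&
    (clamp (y - d / 2) (y + d / 2) z.2 <= y + d / 2) by apply: clamp_itv; lra.
  by split; rewrite /ball /= distrC ltr_distl; apply/andP; split; lra.
split=> [z u v zu zv|z u zu]; last by apply: (@filterE _ _ (nbhs_filter z)).
have Xz := XF (clamp a b z.1, clamp (y - d / 2) (y + d / 2) z.2).
by rewrite (cocycle (pointX_supp Xz)) // (pointX_gt0 _ Xz); [exact: pos|exact: zu|exact: zv].
Qed.

Lemma sec_square : exists phi, sec (box 0 1 0 1) phi.
Proof.
apply: (@interval_induction _ (fun e d => exists phi, sec (box 0 1 e d) phi)).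
  move=> r s t _ rs st _ [phi1 sec1] [phi2 sec2].
  apply: (sec_glue (l := snd) (b := s) _ _ _ _ _ sec1 sec2) => [|||z hz|z hz|z z' hz hz'] //.
  - exact: cts_snd.
  - by move=> z; apply: XF.
  - exact: cts_box.
  - by rewrite /box (clamp_l _ _ hz).
  - by rewrite /box (clamp_r _ _ hz).
  exists (fun t => ((1 - t) * z.1 + t * z'.1, s)); split=> //.
  - by apply: pair_continuous; cts.
  - by case: z hz => ? ? /= ->; rewrite subr0 mul1r mul0r addr0.
  - by case: z' hz' => ? ? /= ->; rewrite subrr mul1r mul0r add0r.
move=> y _ _; have [d d0 [phi sp]] := sec_strip y; exists d => // a b a0 ab b1 ha hb.
by apply: (sec_box_narrow _ _ _ sp); lra.
Qed.

End Square.

(** The change of sheet along [f], read in the chart [u] at the start and [v] at the end.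
    Quantifying over all sections spares the lifting of single paths: [sec_square] supplies a
    section when two paths are compared. *)
Definition monodromy (f : R -> E) u v k : Prop :=
  forall phi, sec f phi -> phi 1 v = phi 0 u (+) k.

Lemma sec_const (f : R -> E) phi u a b : sec f phi -> a <= b ->
  (forall t, a <= t -> t <= b -> 0 < f t u) -> phi a u = phi b u.
Proof.
move=> sp ab pos; pose g t := a + (b - a) * t.
have [_ s2] : sec (f \o g) (phi \o g).
  by apply: sec_comp => //; rewrite -/(cts _) /g; cts.
suff : (phi \o g) 0 u = (phi \o g) 1 u.
  by rewrite /= /g mulr0 addr0 mulr1 addrC subrK.
apply: (@interval_induction _ (fun r s => (phi \o g) r u = (phi \o g) s u)).
  by move=> r s t _ _ _ _ -> ->.
move=> t t0 t1; have gt : 0 < (f \o g) t u by apply: pos; rewrite /g; nra.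
have [e e0 He] := near_itv (s2 _ _ gt).
exists e => // r s r0 rs s1 hr hs; rewrite He ?He //; lra.
Qed.

Lemma monodromy_cst u : ([set u] \in L)%SET -> monodromy (fun=> vertexE u) u u false.
Proof.
move=> uL phi sp; rewrite addbF; apply/esym/(sec_const sp ler01) => t _ _.
by rewrite /vertexE eqxx ltr01.
Qed.

Lemma monodromy_seg u v : ([set u; v] \in L)%SET ->
  monodromy (seg (vertexE u) (vertexE v)) u v (c u v).
Proof.
move=> uv phi sp; set f := seg _ _ in sp.
have [e|nuv] := eqVneq u v.
  subst v; rewrite setUid in uv; rewrite c_refl // addbF.
  apply/esym/(sec_const sp ler01) => t _ _.
  by rewrite /f /seg -mulrDl subrK mul1r /vertexE eqxx ltr01.
have fu t : f t u = 1 - clamp 0 1 t.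
  by rewrite /f /seg /vertexE eqxx (negbTE nuv) mulr1 mulr0 addr0.
have fv t : f t v = clamp 0 1 t.
  by rewrite /f /seg /vertexE eqxx eq_sym (negbTE nuv) mulr1 mulr0 add0r.
have h0 : (0 : R) <= 1 / 2 by lra.
have h1 : (1 / 2 : R) <= 1 by lra.
(* The chart is changed at the midpoint, where both coordinates equal 1/2. *)
rewrite (sec_const sp h0 (u := u)); last first.
  by move=> t t0 t1; rewrite fu clamp_id //; lra.
rewrite -(sec_const sp h1 (u := v)); last first.
  by move=> t t0 t1; rewrite fv clamp_id //; lra.
by apply: sp.1; rewrite ?fu ?fv clamp_id //; lra.
Qed.

Lemma gpath_clamp x y f t : gpath x y f -> f (clamp 0 1 t) = f t.
Proof.
move=> [_ _ f0 f1]; case: (lerP t 0) => ht; first by rewrite clamp_le ?ler01 // !f0.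
case: (lerP 1 t) => ht'; first by rewrite clamp_ge ?ler01 // !f1.
by rewrite clamp_id ?ltW.
Qed.

Lemma monodromy_concat x y z f g u v w k k' : gpath x y f -> gpath y z g ->
  monodromy f u v k -> monodromy g v w k' -> monodromy (concat f g) u w (k (+) k').
Proof.
move=> Pf Pg mf mg phi sp.
have cc : cts (fun t : R => clamp 0 1 t) by apply: (@cts_clamp _ _ _ _ (fun t => t)); cts.
(* [a] and [b] map the unit interval onto its two halves; the section along the concatenation
   restricts to both factors. *)
pose a (t : R) := clamp 0 1 t / 2; pose b (t : R) := (clamp 0 1 t + 1) / 2.
have ca : cts a by rewrite /a; cts.
have cb : cts b by rewrite /b; cts.
have sf : sec f (phi \o a).
  apply: sec_ext (sec_comp sp ca) => t /=; have [c0 c1] := clamp01 t.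
  rewrite (concat_le Pf Pg) /a; last lra.
  by rewrite (_ : 2 * _ = clamp 0 1 t); [exact: gpath_clamp Pf|lra].
have sg : sec g (phi \o b).
  apply: sec_ext (sec_comp sp cb) => t /=; have [c0 c1] := clamp01 t.
  rewrite (concat_ge Pf Pg) /b; last lra.
  by rewrite (_ : 2 * _ - 1 = clamp 0 1 t); [exact: gpath_clamp Pg|lra].
have := mf _ sf; have := mg _ sg; rewrite /= /a /b.
rewrite !(clamp_le (t := 0)) ?ler01 // !(clamp_ge (t := 1)) ?ler01 //.
have -> : ((1 + 1) / 2 : R) = 1 by lra.
by rewrite mul0r add0r => -> ->; rewrite addbA.
Qed.

(** A section over the whole square is read along its boundary: the vertical sides are constant
    paths and contribute nothing, so bottom and top agree. *)
Lemma monodromy_homot f g u v k k' : ([set u] \in L)%SET -> ([set v] \in L)%SET ->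
  homot (vertexE u) (vertexE v) f g -> monodromy f u v k -> monodromy g u v k' ->
  k = k'.
Proof.
move=> uL vL fg mf mg; have Pf := homot_gpathl fg.
have Pg := homot_gpathl (homot_sym fg).
move: fg => [H [cH XH H0 H1 Huv]]; have [phi sp] := sec_square cH XH.
have side h (a b : R -> R) : cts a -> cts b ->
    (forall t, box H 0 1 0 1 (a t, b t) = h t) -> sec h (fun t => phi (a t, b t)).
  move=> ca cb hE; apply: sec_ext hE _.
  by apply: (sec_comp sp (g := fun t => (a t, b t))); apply: pair_continuous.
have bot : phi (1, 0) v = phi (0, 0) u (+) k.
  apply: (mf (fun s => phi (s, 0))); apply: side => [||t]; try by cts.
  by rewrite /box /= (clamp_le _ (lexx 0)) ?ler01 // H0 // (gpath_clamp _ Pf).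
have top : phi (1, 1) v = phi (0, 1) u (+) k'.
  apply: (mg (fun s => phi (s, 1))); apply: side => [||t]; try by cts.
  by rewrite /box /= (clamp_ge _ (lexx 1)) ?ler01 // H1 // (gpath_clamp _ Pg).
have left : phi (0, 1) u = phi (0, 0) u (+) false.
  apply: (monodromy_cst uL (phi := fun t => phi (0, t))); apply: side => [||t]; try by cts.
  by rewrite /box /= (clamp_le _ (lexx 0)) ?ler01 // (Huv _ _).1.
have right : phi (1, 1) v = phi (1, 0) v (+) false.
  apply: (monodromy_cst vL (phi := fun t => phi (1, t))); apply: side => [||t]; try by cts.
  by rewrite /box /= (clamp_ge _ (lexx 1)) ?ler01 // (Huv _ _).2.
move: top; rewrite right left bot !addbF => /(congr1 (addb (phi (0, 0) u))).
by rewrite !addbA addbb.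
Qed.

(** A contractible loop would have the monodromy [false] of the constant path, whereas this one has
    the sum of [c] over its four edges. *)
Theorem not_simply_connected_of_cocycle p a q b :
  ([set p; a] \in L)%SET -> ([set a; q] \in L)%SET ->
  ([set q; b] \in L)%SET -> ([set b; p] \in L)%SET ->
  c p a (+) (c a q (+) (c q b (+) c b p)) -> ~ simply_connected R X.
Proof.
move=> pa aq qb bp hol [_ sc].
have pL : ([set p] \in L)%SET.
  apply: simplex_face pa _ _; first by rewrite sub1set !inE eqxx.
  by apply/set0Pn; exists p; rewrite inE.
have P1 := gpath_seg_edge R pa; have P2 := gpath_seg_edge R aq.
have P3 := gpath_seg_edge R qb; have P4 := gpath_seg_edge R bp.
have P34 := gpath_concat P3 P4; have P234 := gpath_concat P2 P34.
have P := gpath_concat P1 P234.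
have Xp := pointX_vertexE R pL.
have h := homot_of_path_homotopic P (gpath_cst Xp) (sc _ _ Xp (path_of_gpath P)).
have m := monodromy_concat P1 P234 (monodromy_seg pa)
  (monodromy_concat P2 P34 (monodromy_seg aq)
     (monodromy_concat P3 P4 (monodromy_seg qb) (monodromy_seg bp))).
have := monodromy_homot pL pL h m (monodromy_cst pL).
by rewrite hol.
Qed.

End Sections.

(** * The exceptional complexes *)

Local Close Scope classical_set_scope.
Local Close Scope ring_scope.

Section Cut.
Variables (R : realType) (V : finType) (L : simplicial_complex V).
Local Notation X := (geometric_realization R L).

(* If the link of [p] splits into [A] and its complement, the edges from [p] to
   [A] support a cocycle. *)
Lemma not_simply_connected_of_cut (A : pred V) p a q b :
  (forall s u v, s \in L -> p \in s -> u \in s -> v \in s -> u != p -> v != p ->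
     A u -> A v) ->
  a != p -> b != p -> q != p -> A a -> ~~ A b ->
  [set p; a] \in L -> [set a; q] \in L -> [set q; b] \in L -> [set b; p] \in L ->
  ~ simply_connected R X.
Proof.
move=> cut nap nbp nqp Aa Ab pa aq qb bp.
pose c u v := if u == p then (v != p) && A v else (v == p) && A u.
apply: (@not_simply_connected_of_cocycle _ _ _ c _ p a q b) => //; last first.
  by rewrite /c !eqxx (negbTE nap) (negbTE nbp) (negbTE nqp) Aa (negbTE Ab).
move=> s u v w sL us vs ws; rewrite /c.
have eqA u' v' : p \in s -> u' \in s -> v' \in s -> u' != p -> v' != p -> A u' = A v'.
  by move=> ps u's v's nu nv; apply/idP/idP; apply: cut sL ps _ _ _ _.
have [up|nu] := eqVneq u p; have [vp|nv] := eqVneq v p;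
  have [wp|nw] := eqVneq w p; rewrite //= ?addbF ?addbb //.
- by apply: eqA; rewrite // -up.
- by rewrite (eqA u w) ?addbb // -vp.
- by apply: eqA; rewrite // -wp.
Qed.

(** The coordinate at [p] takes only the values 0 and 1 on the realization, so the strict and the
    weak inequality at the threshold 1/2 cut out the same part, which is both open and closed. *)
Lemma not_connected_of_isolated (p q : V) : p != q ->
  [set p] \in L -> [set q] \in L ->
  (forall s, s \in L -> p \in s -> s = [set p]) -> ~ connected X.
Proof.
move=> npq pL qL iso; pose h (x : {ptws V -> R}) := x p.
have ch : continuous h by exact: (@proj_continuous V (fun=> R) p).
have val x : X x -> h x = (if p \in supp x then 1 else 0)%R.
  move=> Xx; case: ifP => [px|/negbT]; last by rewrite inE negbK => /eqP.
  have e := iso _ (pointX_supp Xx) px.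
  by rewrite /h (pointX_supp1 Xx e) /vertexE eqxx.
move=> /(_ (classical_sets.setI X [set x | (1 / 2 < h x)%R]%classic)) cX.
have Xp := pointX_vertexE R pL; have Xq := pointX_vertexE R qL.
have e : classical_sets.setI X [set x | (1 / 2 < h x)%R]%classic = X.
  apply: cX.
  - exists (vertexE R p); split=> //=; rewrite val // supp_vertexE set11; lra.
  - exists [set x | (1 / 2 < h x)%R]%classic => //.
    by apply: (open_comp (f := h)) (@open_gt R (1 / 2)%R) => x _; apply: ch.
  - exists [set x | (1 / 2 <= h x)%R]%classic.
      by apply: (closed_comp (f := h)) (@closed_ge R (1 / 2)%R) => x _; apply: ch.
    apply/seteqP; split=> x /= [Xx]; rewrite val //; case: ifP; split=> //; lra.
have := Xq; rewrite -[X in X _]e => -[_ /=]; rewrite val // supp_vertexE inE (negbTE npq); lra.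
Qed.

End Cut.

Section ExceptionalComplexes.
Variables (R : realType) (T : finType) (K : simplicial_complex T).
Local Notation vec := ({set T} * {set T})%type.
Implicit Types (p q r a b : vec) (u v w x y z : T) (s t : {set T}).
Local Notation prim := (primitive_dvf K).
Local Notation adj := (adjacent K).
Local Notation X := (geometric_realization R (morse_complex K)).

Lemma vec_in_vertices p u : prim p -> u \in p.2 -> u \in vertices K.
Proof. by case=> _ K2 _ _; apply: sub_vertex K2. Qed.

(** With only two vertices the top of every vector is the edge itself, so no two vectors are
    disjoint. *)
Lemma edge_not_connected v w : is_edge K v w -> ~ connected X.
Proof.
move=> [nvw vK vw]; have avw : adj v w by rewrite /adjacent nvw.
have awv : adj w v by rewrite adjC.
have npq : low v w != low w v.
  by apply: contraNneq nvw => -[/set1_inj->].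
apply: (not_connected_of_isolated npq); try by apply/morse1/prim_low.
move=> s sM ps; apply/setP => b; rewrite inE; apply/idP/eqP => [bs|->//].
have Pb := morse_prim sM bs.
have := morse_compat sM ps bs; rewrite /compat => /orP[/eqP-> //|d]; exfalso.
have e2 : b.2 = [set v; w].
  apply/eqP; rewrite eqEcard cards2 nvw (prim_card Pb) ltnS (prim_gt0 Pb) andbT -vK.
  by apply/fintype.subsetP => u; apply: vec_in_vertices Pb.
by case/and4P: d => _ _ _; rewrite /= e2 eqxx.
Qed.

(** In the link of [low w v] the vector [low x y] is isolated: a vector on the possible middle edge
    starts at [w] or at [x]. The loop alternates between the incidences of [vw] and those of
    [xy]. *)
Lemma path_like_not_simply_connected v w x y : is_path_like K v w x y ->
  ~ simply_connected R X.
Proof.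
move=> [u4 vK Kvw Kxy sK]; move: u4; rewrite /= !inE !negb_or.
move=> /and4P[/and3P[nvw nvx nvy] /andP[nwx nwy] nxy _].
have avw : adj v w by rewrite /adjacent nvw.
have awv : adj w v by rewrite adjC.
have axy : adj x y by rewrite /adjacent nxy.
have ayx : adj y x by rewrite adjC.
have nwv : w != v by rewrite eq_sym.
have nyx : y != x by rewrite eq_sym.
have neE : [set v; w] != [set x; y].
  by apply/eqP => /eq_set2; case=> -[e _]; [rewrite e eqxx in nvx|rewrite e eqxx in nvy].
have neE2 : [set w; v] != [set x; y] by rewrite setUC.
have C1 : compat (low w v) (low x y).
  by apply: disj_compat; rewrite disj_low_low // nwx neE2.
have C2 : compat (low x y) (low v w).
  by rewrite compatC; apply: disj_compat; rewrite disj_low_low // nvx neE.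
have C3 : compat (low v w) (low y x).
  by apply: disj_compat; rewrite disj_low_low // nvy (setUC [set y]) neE.
have C4 : compat (low y x) (low w v).
  by rewrite compatC; apply: disj_compat; rewrite disj_low_low // nwy (setUC [set y]) neE2.
have ne (a b a' b' : T) : a != b -> low a a' != low b b'.
  by apply: contraNneq => -[/set1_inj->].
apply: (@not_simply_connected_of_cut R _ _ (pred1 (low x y)) (low w v) (low x y)
  (low v w) (low y x)) => /=; try by [apply: morse2 => //; apply: prim_low|rewrite ?ne // eq_sym].
move=> s p q sM es ps qs np nq /eqP ep; subst p.
apply: contraT => nqx; have Pq := morse_prim sM qs.
have disj_of a b : a \in s -> b \in s -> a != b -> disj a b.
  by move=> as_ bs nab; have := morse_compat sM as_ bs; rewrite /compat (negbTE nab).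
have D1 : disj (low w v) q by apply: disj_of; rewrite // eq_sym.
have D2 : disj (low x y) q by apply: disj_of; rewrite // eq_sym.
have Kq : q.2 \in K by case: Pq.
have c2 : (1 < #|q.2|)%N by rewrite (prim_card Pq) ltnS (prim_gt0 Pq).
case: (sK _ Kq c2) => e2.
- by case/and4P: D1 => _ _ _; rewrite /= e2 setUC eqxx.
- have c1 : #|q.1| = 1%N by have := prim_card Pq; rewrite e2 cards2 nwx => -[].
  have [u [u' [_ e]]] := prim_eq_low Pq c1; subst q.
  by case: (eq_set2 e2) => -[eu _]; [case/and4P: D1|case/and4P: D2]; rewrite /= eu eqxx.
by case/and4P: D2 => _ _ _; rewrite /= e2 eqxx.
Qed.

(** In the link of [low x y], one side of the cut consists of the vectors on the edge [yz] and, in a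
    2-simplex, the pair [(xz, xyz)]. The only disjoint vectors across the cut are [low y z] and
    [low z x], and together with [low x y] they form a closed V-path, so they are not joined in the
    link. The loop is this hollow triangle. *)
Lemma triangle_like_not_simply_connected x y z : is_triangle_like K x y z ->
  ~ simply_connected R X.
Proof.
move=> [u3 vK [Kxy Kyz Kxz]]; move: u3; rewrite /= !inE !negb_or.
move=> /and3P[/andP[nxy nxz] nyz _].
have nyx : y != x by rewrite eq_sym.
have nzx : z != x by rewrite eq_sym.
have nzy : z != y by rewrite eq_sym.
have axy : adj x y by rewrite /adjacent nxy.
have ayz : adj y z by rewrite /adjacent nyz.
have azx : adj z x by rewrite adjC /adjacent nxz.
have nE (a b c : T) : c != a -> [set a; b] != [set c; b].
  move=> nca; apply/eqP => /eq_set2; case=> -[e1 e2].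
    by rewrite e1 eqxx in nca.
  by rewrite e1 e2 eqxx in nca.
have E1 : [set x; y] != [set y; z] by rewrite (setUC [set y]) nE.
have E2 : [set y; z] != [set z; x] by rewrite (setUC [set z]) nE.
have E3 : [set z; x] != [set x; y] by rewrite (setUC [set x]) nE // eq_sym.
have C1 : compat (low x y) (low y z) by apply: disj_compat; rewrite disj_low_low // nxy.
have C2 : compat (low y z) (low z x) by apply: disj_compat; rewrite disj_low_low // nyz.
have C3 : compat (low z x) (low x y) by apply: disj_compat; rewrite disj_low_low // nzx.
have Px := prim_low axy; have Py := prim_low ayz; have Pz := prim_low azx.
have ne (a b a' b' : T) : a != b -> low a a' != low b b'.
  by apply: contraNneq => -[/set1_inj->].
pose A q := (q.2 == [set y; z]) || (q.1 == [set x; z]).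
(* The loop has three edges only, so its last corner is repeated. *)
apply: (@not_simply_connected_of_cut R _ _ A (low x y) (low y z) (low z x) (low z x));
  rewrite ?ne // ?morse2 ?compatxx //.
- move=> s p q sM ls ps qs np nq Ap; apply: contraT; rewrite /A negb_or => /andP[nq2 nq1].
  have npq : p != q.
    by apply: contraTneq Ap => ->; rewrite /A negb_or nq2.
  have disj_of a b : a \in s -> b \in s -> a != b -> disj a b.
    by move=> as_ bs nab; have := morse_compat sM as_ bs; rewrite /compat (negbTE nab).
  have dp : disj (low x y) p by apply: disj_of; rewrite // eq_sym.
  have dq : disj (low x y) q by apply: disj_of; rewrite // eq_sym.
  have dpq : disj p q by apply: disj_of.
  have Pp := morse_prim sM ps; have Pq := morse_prim sM qs.
  have V3 u r : prim r -> u \in r.2 -> [|| u == x, u == y | u == z].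
    by move=> Pr ur; have := vec_in_vertices Pr ur; rewrite vK !inE -orbA.
  have pair (r : {set T}) : #|r| = 2 -> r \subset [set x; y; z] ->
      [\/ r = [set x; y], r = [set y; z] | r = [set x; z]].
    move=> /eqP/cards2P[u [u' [nu ->]]]; rewrite subUset !sub1set !inE -!orbA.
    move=> /andP[/or3P[] /eqP eu /or3P[] /eqP eu']; subst u u'; rewrite ?eqxx // in nu *;
      by [apply: Or31; rewrite // setUC|apply: Or32; rewrite // setUC|apply: Or33; rewrite // setUC].
  have c3 : #|[set x; y; z]| = 3.
    by rewrite -setUA cardsU1 cards2 !inE negb_or nxy nxz nyz.
  have sub2 r : prim r -> r.2 \subset [set x; y; z].
    by move=> Pr; apply/fintype.subsetP => u /(V3 _ _ Pr); rewrite !inE -orbA.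
  have cls r : prim r ->
      (exists u u', r = low u u' /\
        [\/ [set u; u'] = [set x; y], [set u; u'] = [set y; z] | [set u; u'] = [set x; z]])
      \/ ([\/ r.1 = [set x; y], r.1 = [set y; z] | r.1 = [set x; z]] /\ r.2 = [set x; y; z]).
    move=> Pr; have [c1|c1] := eqVneq #|r.1| 1%N.
      have [u [u' [uu' e]]] := prim_eq_low Pr c1; left; exists u, u'; split=> //.
      have := sub2 r Pr; rewrite e /=; apply: pair.
      by rewrite cards2; case/andP: uu' => ->.
    have le : (#|r.2| <= 3)%N by rewrite -c3 subset_leq_card // sub2.
    have c2 : #|r.1| = 2.
      have c0 := prim_gt0 Pr; rewrite (prim_card Pr) in le.
      by case: #|r.1| c1 c0 le => [|[|[|]]].
    right; split.
      by apply: pair c2 _; apply: fintype.subset_trans (prim_sub Pr) (sub2 _ Pr).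
    by apply/eqP; rewrite eqEcard sub2 // c3 (prim_card Pr) c2.
  have pE : (p = low y z \/ p = low z y) \/ (p.1 = [set x; z] /\ p.2 = [set x; y; z]).
    case: (cls _ Pp) => [[u [u' [e cs]]]|[_ e2]]; last first.
      case/orP: Ap => /eqP e; last by right.
      by move: c3; rewrite -e2 e cards2 nyz.
    left; rewrite e; case/orP: Ap; rewrite e /= => /eqP e'.
      by case: (eq_set2 e') => -[-> ->]; tauto.
    by have := congr1 (fun r : {set T} => #|r|) e'; rewrite /= cards1 cards2 nxz.
  have qE : q = low z x \/ (q.1 = [set y; z] /\ q.2 = [set x; y; z]).
    case: (cls _ Pq) => [[u [u' [e cs]]]|[cs e2]].
      left; move: dq nq2; rewrite e /disj /= => /and4P[d1 _ _ d4] n2.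
      case: cs => cs; [by rewrite cs eqxx in d4|by rewrite cs eqxx in n2|].
      by case: (eq_set2 cs) => -[eu eu']; [rewrite eu eqxx in d1|rewrite eu eu'].
    right; split=> //; case: cs => // e1; last by rewrite e1 eqxx in nq1.
    by case/and4P: dq => _ _; rewrite /= e1 eqxx.
  exfalso; case: qE => [eq|[q1 q2]]; case: pE => [[ep|ep]|[p1 p2]]; subst.
  - have dq' : disj (low z x) (low x y) by rewrite disjC.
    have := morse_no_cyc3 sM ls ps qs dp dpq dq'.
    by rewrite /cyc3 /= !(inj_eq set1_inj) nxy nyz nzx !sub1set !inE !eqxx !orbT.
  - by case/and4P: dpq; rewrite /= eqxx.
  - by case/and4P: dpq => _; rewrite p1 /= setUC eqxx.
  - by case/and4P: dpq => _ _; rewrite q1 /= eqxx.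
  - by case/and4P: dpq => _ _; rewrite q1 /= setUC eqxx.
  - by case/and4P: dpq => _ _ _; rewrite p2 q2 eqxx.
- by rewrite /A eqxx.
rewrite /A /= negb_or [_ == [set y; z]]eq_sym E2 /=.
by apply: cards_neq; rewrite cards1 cards2 nxz.
Qed.

End ExceptionalComplexes.

Theorem theorem5p4 (R : realType) (T : finType) (K : simplicial_complex T)
    (no_isolated : forall v : T, ~ isolated_vertex K v) :
  (connected (geometric_realization R (morse_complex K))
     <-> ~ isomorphic K edge)
  /\
  (simply_connected R (geometric_realization R (morse_complex K))
     <-> [/\ ~ isomorphic K edge,
             ~ isomorphic K two_edges,
             ~ isomorphic K path_three_edges,
             ~ isomorphic K three_cycle &
             ~ isomorphic K two_simplex]).
Proof.
have no_iso v : v \in vertices K -> exists z, adjacent K v z.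
  move=> vK; have [[e [Ke de ve]]|ne] := pselect (exists e, [/\ e \in K, dim e = 1%N & v \in e]); last first.
    by case: (no_isolated v).
  have /card_gt0P[z] : (0 < #|e :\ v|)%N.
    by move: de; rewrite /dim (cardsD1 v) ve add1n /= => ->.
  by rewrite !inE => /andP[nz ze]; exists z; apply: sub_adj Ke ve ze _; rewrite eq_sym.
have edge_nc : isomorphic K edge -> ~ connected (geometric_realization R (morse_complex K)).
  by move=> /isomorphic_edgeP[v [w]]; apply: edge_not_connected.
have not_edge : ~ isomorphic K edge -> forall v w, ~ is_edge K v w.
  by move=> ne v w vw; apply: ne; apply/isomorphic_edgeP; exists v, w.
split; split.
- by move=> cX /edge_nc.
- move=> ne; apply: connected_of_graph => Q step p q pM qM.
  apply: (morse_graph_connected no_iso (not_edge ne)).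
  + by move=> r s Pr Ps rs; apply: step; apply: morse2 => //; apply: disj_compat.
  + by apply: morse_prim pM _; rewrite inE.
  + by apply: morse_prim qM _; rewrite inE.
- move=> sc; split=> iso.
  + exact: edge_nc iso (connected_of_simply_connected sc).
  + have [v [w [x [y H]]]] := (isomorphic_path_likeP K).1 (or_introl iso).
    exact: path_like_not_simply_connected H sc.
  + have [v [w [x [y H]]]] := (isomorphic_path_likeP K).1 (or_intror iso).
    exact: path_like_not_simply_connected H sc.
  + have [x [y [z H]]] := (isomorphic_triangleP K).1 (or_introl iso).
    exact: triangle_like_not_simply_connected H sc.
  + have [x [y [z H]]] := (isomorphic_triangleP K).1 (or_intror iso).
    exact: triangle_like_not_simply_connected H sc.
move=> [n1 n2 n3 n4 n5]; apply: simply_connected_of_flat.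
apply: morse_flat_sections => //; first exact: not_edge.
  move=> v w x y H; have [] // := (isomorphic_path_likeP K).2.
  by exists v, w, x, y.
move=> x y z H; have [] // := (isomorphic_triangleP K).2.
by exists x, y, z.
Qed.
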